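(* Let $n\ge2$, $r>0$, $x^0\in\mathbb{R}^n$, and let $f:\operatorname{dom} f\subseteq\mathbb{R}^n\to\mathbb{R}$ be $\mathcal{C}^3$ on an open domain containing $B_n(x^0;r)$. Let $L_H$ denote the Lipschitz constant of $\nabla^2f$ on $B_n(x^0;r)$, let $$\eta=\frac{\Gamma\left(\frac{n+4}{2}\right)}{\sqrt\pi\,\Gamma\left(\frac{n+3}{2}\right)},$$ and let $\Delta_S=r$. For each $(N_1,\dots,N_n)$ with all $N_i>2$, let $S\in\mathbb{R}^{n\times N}$, $N=N_1\cdots N_n$, be a matrix such that the sample points $x^0+Se_j$, $j\in\{1,\dots,N\}$, consist of exactly one arbitrary point in each cell of the polar grid partition of $B_n(x^0;r)$ (as defined in the context). Then $$\left\|\lim_{\vec N\to\vec\infty}\nabla_sf(x^0;S)-\nabla f(x^0)\right\|\le\frac{\sqrt n}{3\sqrt\pi}\,L_H\,\eta\,\Delta_S^2.$$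
   Context: $B_n(x^0;r)=\{x\in\mathbb{R}^n:\|x-x^0\|\le r\}$; $\|\cdot\|$ is the Euclidean norm on vectors and the induced operator norm on matrices; $\Gamma$ is the Gamma function. Polar grid: write $n$-spherical coordinates as $x_1=\rho\cos\phi_1$, $x_k=\rho\sin\phi_1\cdots\sin\phi_{k-1}\cos\phi_k$ for $2\le k\le n-2$, $x_{n-1}=\rho\sin\phi_1\cdots\sin\phi_{n-2}\cos\theta$, $x_n=\rho\sin\phi_1\cdots\sin\phi_{n-2}\sin\theta$ (for $n=2$: $x_1=\rho\cos\theta$, $x_2=\rho\sin\theta$), with $\theta$ ranging over $[0,2\pi)$ and each $\phi_i$ over $[0,\pi)$. Put $\Delta_1=r$, $\Delta_2=2\pi$, $\Delta_3=\dots=\Delta_n=\pi$ and $\overline\Delta_i=\Delta_i/N_i$. For $\vec y=(y_1,\dots,y_n)$ with $y_i\in\{1,\dots,N_i\}$, the cell of the partition of $B_n(x^0;r)$ with index $\vec y$ is the set of points $x^0+x$ where $x$ has spherical coordinates with $\rho\in[(y_1-1)\overline\Delta_1,y_1\overline\Delta_1]$, $\theta\in[(y_2-1)\overline\Delta_2,y_2\overline\Delta_2]$ and $\phi_k\in[(y_{k+2}-1)\overline\Delta_{k+2},y_{k+2}\overline\Delta_{k+2}]$ for $k=1,\dots,n-2$. The generalized simplex gradient (GSG) is $\nabla_sf(x^0;S)=(S^\dagger)^\top\delta_f(x^0;S)$, where $S^\dagger$ is the Moore--Penrose pseudoinverse and $\delta_f(x^0;S)=[f(x^0+Se_1)-f(x^0),\dots,f(x^0+Se_N)-f(x^0)]^\top\in\mathbb{R}^N$.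 $\lim_{\vec N\to\vec\infty}$ denotes the limit as $N_1\to\infty,\dots,N_n\to\infty$ jointly. *)

(* Defs.v *)
From HB Require Import structures.
From mathcomp Require Import all_boot all_order all_algebra.
From mathcomp Require Import all_classical all_reals all_analysis.

Set Implicit Arguments.
Unset Strict Implicit.
Unset Printing Implicit Defensive.

Import Order.TTheory GRing.Theory Num.Theory.
Import numFieldNormedType.Exports.

Local Open Scope classical_set_scope.
Local Open Scope ring_scope.

(* The library's norm `|x| on matrices is the max norm, hence the explicit
   Euclidean and induced operator norms below. *)
Definition enorm (R : realType) (n : nat) (x : 'cV[R]_n) : R :=
  Num.sqrt (\sum_(i < n) x i 0 ^+ 2).

Definition opnorm (R : realType) (m n : nat) (A : 'M[R]_(m, n)) : R :=
  sup [set enorm (A *m v) | v in [set v : 'cV[R]_n | enorm v <= 1]].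

Definition eball (R : realType) (n : nat) (x0 : 'cV[R]_n) (r : R)
  : set 'cV[R]_n := [set x | enorm (x - x0) <= r].

Definition basis_vec (R : realType) (n : nat) (i : 'I_n) : 'cV[R]_n :=
  delta_mx i 0.

Definition partial (R : realType) (n : nat) (i : 'I_n) (f : 'cV[R]_n -> R)
  : 'cV[R]_n -> R := fun x => 'D_(basis_vec R i) f x.

(* f is of class C^k on U (meant for U open): all iterated partial derivatives
   of order at most k exist and are continuous on U. *)
Fixpoint class_C (R : realType) (n k : nat) (U : set 'cV[R]_n)
    (f : 'cV[R]_n -> R) : Prop :=
  match k with
  | 0 => forall x, U x -> {for x, continuous f}
  | k'.+1 =>
      (forall x, U x -> {for x, continuous f}) /\
      (forall i : 'I_n,
         (forall x, U x -> derivable f x (basis_vec R i)) /\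
         class_C k' U (partial i f))
  end.

Definition grad (R : realType) (n : nat) (f : 'cV[R]_n -> R) (x : 'cV[R]_n)
  : 'cV[R]_n := \col_(i < n) partial i f x.

Definition hessian (R : realType) (n : nat) (f : 'cV[R]_n -> R)
    (x : 'cV[R]_n) : 'M[R]_n :=
  \matrix_(i < n, j < n) partial i (partial j f) x.

Definition lipschitz_hessian (R : realType) (n : nat) (f : 'cV[R]_n -> R)
    (B : set 'cV[R]_n) (L : R) : Prop :=
  forall x y, B x -> B y ->
    opnorm (hessian f x - hessian f y) <= L * enorm (x - y).

Definition Gamma (R : realType) (a : R) : R :=
  \int[@lebesgue_measure R]_(t in `]0, +oo[) (t `^ (a - 1) * expR (- t)).

Definition eta_const (R : realType) (n : nat) : R :=
  Gamma ((n + 4)%:R / 2) / (Num.sqrt pi * Gamma ((n + 3)%:R / 2)).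

(* The four Penrose conditions. *)
Definition is_pinv (R : realType) (m n : nat) (A : 'M[R]_(m, n))
    (X : 'M[R]_(n, m)) : Prop :=
  [/\ A *m X *m A = A, X *m A *m X = X,
      (A *m X)^T = A *m X & (X *m A)^T = X *m A].

(* The default value 0 is never used: see pinvP. *)
Definition pinv (R : realType) (m n : nat) (A : 'M[R]_(m, n))
  : 'M[R]_(n, m) := xget 0 [set X | is_pinv A X].

Lemma is_pinv_unique (R : realType) (m n : nat) (A : 'M[R]_(m, n))
  (X Y : 'M[R]_(n, m)) : is_pinv A X -> is_pinv A Y -> X = Y.
Proof.
move=> [X1 X2 X3 X4] [Y1 Y2 Y3 Y4].
have AXY : A *m X = A *m Y.
  rewrite -X3 -{1}Y1 -!mulmxA mulmxA trmx_mul X3 Y3.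
  by rewrite mulmxA X1.
have XAY : X *m A = Y *m A.
  rewrite -X4 -{1}Y1 2!mulmxA -mulmxA trmx_mul X4 Y4.
  by rewrite -mulmxA [A *m (X *m A)]mulmxA X1.
by rewrite -X2 XAY -mulmxA AXY mulmxA Y2.
Qed.

Lemma gram_unitmx (R : realType) (m n : nat) (C : 'M[R]_(m, n)) :
  row_free C -> C *m C^T \in unitmx.
Proof.
move=> freeC; rewrite -row_free_unit -kermx_eq0; apply/eqP/row_matrixP => i.
rewrite row0; set v := row i _.
have vCC : v *m (C *m C^T) = 0 by rewrite /v -row_mul mulmx_ker row0.
have : (v *m C) *m (v *m C)^T = 0.
  by rewrite trmx_mul mulmxA -[v *m C *m _]mulmxA vCC mul0mx.
move=> /matrixP/(_ 0 0); rewrite !mxE => sum0.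
have vC0 : v *m C = 0.
  apply/rowP => j; rewrite [RHS]mxE; apply/eqP.
  rewrite -sqrf_eq0 expr2.
  have /psumr_eq0P H : forall k : 'I_n, true ->
      0 <= (v *m C) 0 k * (v *m C)^T k 0.
    by move=> k _; rewrite [_^T _ _]mxE -expr2 sqr_ge0.
  by have := H sum0 j isT; rewrite [_^T _ _]mxE => ->.
by apply: (row_free_inj freeC); rewrite mul0mx.
Qed.

Lemma is_pinv_exists (R : realType) (m n : nat) (A : 'M[R]_(m, n)) :
  exists X, is_pinv A X.
Proof.
have [k [B [C [BC uC uB]]]] : exists k (B : 'M[R]_(m, k)) (C : 'M[R]_(k, n)),
    [/\ B *m C = A, C *m C^T \in unitmx & B^T *m B \in unitmx].
  exists (\rank A), (col_base A), (row_base A); split.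
  - exact: mulmx_base.
  - exact/gram_unitmx/row_base_free.
  - have := @gram_unitmx R _ _ (col_base A)^T; rewrite trmxK; apply.
    by rewrite /row_free mxrank_tr; have := col_base_full A.
set P := C^T *m invmx (C *m C^T); set Q := invmx (B^T *m B) *m B^T.
have CP : C *m P = 1%:M by rewrite mulmxA mulmxV.
have QB : Q *m B = 1%:M by rewrite -mulmxA mulVmx.
have AX : A *m (P *m Q) = B *m Q.
  by rewrite -BC mulmxA -[B *m C *m P]mulmxA CP mulmx1.
have XA : (P *m Q) *m A = P *m C.
  by rewrite -BC mulmxA -[P *m Q *m B]mulmxA QB mulmx1.
exists (P *m Q); split.
- by rewrite AX -BC mulmxA -[B *m Q *m B]mulmxA QB mulmx1.
- by rewrite XA mulmxA -[P *m C *m P]mulmxA CP mulmx1.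
- rewrite AX /Q !trmx_mul trmx_inv trmx_mul !trmxK.
  by rewrite mulmxA.
- rewrite XA /P !trmx_mul trmx_inv trmx_mul !trmxK.
  by rewrite mulmxA.
Qed.

Lemma pinvP (R : realType) (m n : nat) (A : 'M[R]_(m, n)) :
  is_pinv A (pinv A).
Proof. by have [X AX] := is_pinv_exists A; apply: (xgetI 0 AX). Qed.

Definition delta_f (R : realType) (n N : nat) (f : 'cV[R]_n -> R)
    (x0 : 'cV[R]_n) (S : 'M[R]_(n, N)) : 'cV[R]_N :=
  \col_(j < N) (f (x0 + col j S) - f x0).

Definition gsg (R : realType) (n N : nat) (f : 'cV[R]_n -> R)
    (x0 : 'cV[R]_n) (S : 'M[R]_(n, N)) : 'cV[R]_n :=
  (pinv S)^T *m delta_f f x0 S.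

(* Row i : 'I_n holds the coordinate x_k with k = i + 1; only phi 1, ...,
   phi (n - 2) are used. *)
Definition spherical (R : realType) (n : nat) (rho theta : R) (phi : nat -> R)
  : 'cV[R]_n :=
  \col_(i < n)
    let k := i.+1 in
    if (k <= n - 2)%N then rho * (\prod_(1 <= l < k) sin (phi l)) * cos (phi k)
    else rho * (\prod_(1 <= l < n - 1) sin (phi l)) *
         (if k == (n - 1)%N then cos theta else sin theta).

(* Delta_k, with k counted from 1. *)
Definition grid_range (R : realType) (r : R) (k : nat) : R :=
  if k == 1%N then r else if k == 2%N then 2 * pi else pi.

(* The cell with index (y_1, ..., y_n), where y_k = y i for i = k - 1.
   The spherical coordinates are gathered, in the order of the indices of the
   grid, as s 1 = rho, s 2 = theta, s (k + 2) = phi_k. *)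
Definition polar_cell (R : realType) (n : nat) (x0 : 'cV[R]_n) (r : R)
    (N y : 'I_n -> nat) : set 'cV[R]_n :=
  [set z | exists s : nat -> R,
     (forall i : 'I_n,
        let D := grid_range r i.+1 / (N i)%:R in
        ((y i)%:R - 1) * D <= s i.+1 <= (y i)%:R * D) /\
     z = x0 + spherical n (s 1%N) (s 2%N) (fun k => s (k + 2)%N)].

(* One sample point per cell: the columns of S correspond bijectively to the
   cells. Elements of 'I_(N i) run from 0 to N i - 1, hence the shift by 1. *)
Definition polar_sample (R : realType) (n : nat) (x0 : 'cV[R]_n) (r : R)
    (N : 'I_n -> nat) (S : 'M[R]_(n, \prod_(i < n) N i)) : Prop :=
  exists Y : 'I_(\prod_(i < n) N i) -> {dffun forall i : 'I_n, 'I_(N i)},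
    bijective Y /\
    forall j, polar_cell x0 r N (fun i => (Y j i).+1) (x0 + col j S).

(* N_1, ..., N_n tend to infinity jointly. *)
Definition multi_infty (n : nat) : set_system ('I_n -> nat) :=
  filter_from [set: nat] (fun K => [set N | forall i, (K <= N i)%N]).
Arguments multi_infty : clear implicits.

Global Instance multi_infty_filter (n : nat) : ProperFilter (multi_infty n).
Proof.
apply: filter_from_proper; last by move=> K _; exists (fun=> K) => i /=.
apply: filter_from_filter; first by exists 0%N.
move=> K1 K2 _ _; exists (maxn K1 K2) => // N le_N.
by split => i; apply: leq_trans (le_N i); rewrite ?leq_maxl ?leq_maxr.
Qed.

(* Main.v *)
Require Import Defs.
From mathcomp Require Import all_boot all_order all_algebra.
From mathcomp Require Import all_classical all_reals all_analysis.
From mathcomp Require Import measurable_realfun.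
From mathcomp Require Import zify ring lra.
Import Order.TTheory GRing.Theory Num.Theory numFieldNormedType.Exports.
Set Implicit Arguments.
Unset Strict Implicit.
Unset Printing Implicit Defensive.
Local Open Scope classical_set_scope.
Local Open Scope ring_scope.

(** The cells are equal boxes in the parameters (rho, theta, phi_1, ...), so the
    sample points are equidistributed in the parameters (and not in volume).
    For a continuous g, the average of g over the columns of S therefore tends
    to E[g(x)], where x is the point whose polar parameters are independent and
    uniform.  Let x_k = rho c_k.  The coordinate c_k is a product of sines and
    cosines of kap = min (k, n - 1) angles, so E[c_k^2] = 2^-kap, and the law of
    x is invariant under changing the sign of any single coordinate, because
    each such change is a reflection of one angle.

    Since gsg = (S S^T / N)^-1 (S delta_f / N), this gives the limit: S S^T / N
    tends to the diagonal matrix of the E[x_k^2] = (r^2 / 3) 2^-kap, and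
    S delta_f / N to the vector of the E[x_k (f(x0 + x) - f(x0))].  The k-th
    coordinate of the error is
      (E[x_k (f(x0 + x) - f(x0))] - E[x_k^2] d_k f(x0)) / E[x_k^2].

    By the sign symmetries, f(x0 + x) may be replaced in the numerator by its
    part Q that is odd in x_k and even in the vector x' of the other
    coordinates; the constant and the quadratic Taylor terms disappear from Q.
    The Taylor bound |Q - x_k d_k f(x0)| <= (L/6) rho^3 alone is too weak,
    because 2^kap E|c_k| grows exponentially with k.  But Q is odd in x_k, and
    shrinking x' to l x' changes Q by at most (L/2) |x_k| |x'|^2 (1 - l^2).
    Shrinking until |l x'| = sqrt 3 |x_k| and then using Taylor gives, with
    u = |c_k|, the bound (L/6) rho^3 (3u - 4u^3) for u <= 1/2
    ([odd_part_bound]).  In all cases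
      |x_k (Q - x_k d_k f(x0))| <= (L/6) rho^4 (3u^2 - (7/2) u^4 + (3/2) u^6),
    whose mean is explicit, and the k-th error is at most
      (L r^2 / 10) (3 - (7/2) (3/4)^kap + (3/2) (5/8)^kap).

    The squares of these bounds add up to at most L^2 r^4 n (n + 2) / 200
    ([sum_relative_weight]).  On the other side, the log-convexity of Gamma and
    Gamma (a + 1) = a Gamma (a) give eta^2 >= (n + 2) / (2 pi)
    ([eta_const_ge]), so that the square of the claimed bound is at least
    L^2 r^4 n (n + 2) / (18 pi^2), and pi <= 10/3 concludes.

    The mean E is realized as the limit of means over midpoint grids of the
    parameter box ([riemann_sum_cvg]).  On a grid with an even number of points
    in each direction the sign symmetries are exact permutations of the grid,
    means of products of functions of one parameter factor, and the
    trigonometric moments are exact, so that no multiple integral is needed. *)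

(** * Euclidean and operator norms *)

Lemma enorm_ge0 (R : realType) n (x : 'cV[R]_n) : 0 <= enorm x.
Proof. exact: sqrtr_ge0. Qed.

Lemma sqr_enorm (R : realType) n (x : 'cV[R]_n) :
  enorm x ^+ 2 = \sum_(i < n) x i 0 ^+ 2.
Proof. by rewrite sqr_sqrtr// sumr_ge0// => i _; rewrite sqr_ge0. Qed.

Lemma enorm_eq0 (R : realType) n (x : 'cV[R]_n) : enorm x = 0 -> x = 0.
Proof.
move=> x0; apply/colP => i; rewrite mxE; apply/eqP; rewrite -sqrf_eq0.
have /psumr_eq0P H : forall k : 'I_n, true -> 0 <= x k 0 ^+ 2.
  by move=> k _; rewrite sqr_ge0.
by rewrite H// -sqr_enorm x0 expr0n.
Qed.

Lemma enormZ (R : realType) n (a : R) (x : 'cV[R]_n) :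
  enorm (a *: x) = `|a| * enorm x.
Proof.
rewrite /enorm -sqrtr_sqr -sqrtrM ?sqr_ge0// mulr_sumr.
by congr Num.sqrt; apply: eq_bigr => i _; rewrite mxE exprMn.
Qed.

Lemma enormN (R : realType) n (x : 'cV[R]_n) : enorm (- x) = enorm x.
Proof. by rewrite -scaleN1r enormZ normrN1 mul1r. Qed.

Lemma cauchy_schwarz (R : realType) n (u v : 'cV[R]_n) :
  `|\sum_(i < n) u i 0 * v i 0| <= enorm u * enorm v.
Proof.
have [u0|u0] := eqVneq (enorm u) 0.
  rewrite u0 mul0r (enorm_eq0 u0) big1 ?normr0// => i _.
  by rewrite mxE mul0r.
have [v0|v0] := eqVneq (enorm v) 0.
  rewrite v0 mulr0 (enorm_eq0 v0) big1 ?normr0// => i _.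
  by rewrite mxE mulr0.
have a0 : 0 < enorm u by rewrite lt_def u0 enorm_ge0.
have b0 : 0 < enorm v by rewrite lt_def v0 enorm_ge0.
set a := enorm u in a0 *; set b := enorm v in b0 *.
set s := \sum_(i < n) _.
(* the squared norm of b u - e a v is nonnegative for both signs e *)
have H (e : R) : e ^+ 2 = 1 -> e * s <= a * b.
  move=> e1.
  have : 0 <= \sum_(i < n) (b * u i 0 - e * a * v i 0) ^+ 2.
    by apply: sumr_ge0 => i _; rewrite sqr_ge0.
  have -> : \sum_(i < n) (b * u i 0 - e * a * v i 0) ^+ 2 =
      b ^+ 2 * a ^+ 2 + a ^+ 2 * b ^+ 2 - 2 * e * a * b * s.
    have Ea : a ^+ 2 = \sum_(i < n) u i 0 ^+ 2 by exact: sqr_enorm.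
    have Eb : b ^+ 2 = \sum_(i < n) v i 0 ^+ 2 by exact: sqr_enorm.
    rewrite {1}Ea {2}Eb /s !mulr_sumr -sumrN -!big_split /=.
    by apply: eq_bigr => i _; ring: e1.
  have -> : b ^+ 2 * a ^+ 2 + a ^+ 2 * b ^+ 2 - 2 * e * a * b * s =
    (2 * a * b) * (a * b - e * s) by ring.
  by rewrite pmulr_rge0 ?subr_ge0// !mulr_gt0.
rewrite ler_norml lerNl; apply/andP; split.
  by rewrite -mulN1r H// sqrrN expr1n.
by rewrite -[s]mul1r H// expr1n.
Qed.

Lemma enormD (R : realType) n (x y : 'cV[R]_n) : enorm (x + y) <= enorm x + enorm y.
Proof.
rewrite -(@ler_pXn2r _ 2)// ?nnegrE ?addr_ge0 ?enorm_ge0//.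
have -> : enorm (x + y) ^+ 2 =
    enorm x ^+ 2 + enorm y ^+ 2 + 2 * \sum_(i < n) x i 0 * y i 0.
  rewrite !sqr_enorm mulr_sumr -!big_split/=.
  by apply: eq_bigr => i _; rewrite mxE; ring.
have := cauchy_schwarz x y; have := ler_norm (\sum_(i < n) x i 0 * y i 0).
by move=> h1 h2; have := le_trans h1 h2; rewrite sqrrD mulr_natl; lra.
Qed.

Lemma coord_le_enorm (R : realType) n (x : 'cV[R]_n) i : `|x i 0| <= enorm x.
Proof.
rewrite -(@ler_pXn2r _ 2)// ?nnegrE ?enorm_ge0// real_normK ?num_real// sqr_enorm.
by rewrite (bigD1 i)//= lerDl sumr_ge0// => j _; rewrite sqr_ge0.
Qed.

Lemma enorm_le_sum (R : realType) n (x : 'cV[R]_n) : enorm x <= \sum_(i < n) `|x i 0|.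
Proof.
have S0 : 0 <= \sum_(i < n) `|x i 0| by apply: sumr_ge0.
rewrite -(@ler_pXn2r _ 2)// ?nnegrE ?enorm_ge0// sqr_enorm expr2 mulr_suml.
apply: ler_sum => i _; rewrite -real_normK ?num_real// expr2 ler_wpM2l//.
by rewrite (bigD1 i)//= lerDl sumr_ge0.
Qed.

Lemma enormDorth (R : realType) n (u w : 'cV[R]_n) (s t : R) :
  \sum_(i < n) u i 0 * w i 0 = 0 ->
  enorm (s *: u + t *: w) ^+ 2 = s ^+ 2 * enorm u ^+ 2 + t ^+ 2 * enorm w ^+ 2.
Proof.
move=> uw; rewrite !sqr_enorm !mulr_sumr -big_split/=.
have E : \sum_(i < n) 2 * s * t * (u i 0 * w i 0) = 0 by rewrite -mulr_sumr uw mulr0.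
rewrite -[RHS]addr0 -[X in _ = _ + X]E -big_split/=.
by apply: eq_bigr => i _; rewrite !mxE; ring.
Qed.

(** The Frobenius norm is an upper bound; without one, the supremum that defines
    the operator norm would carry no information. *)
Lemma has_ubound_opnorm (R : realType) m n (A : 'M[R]_(m, n)) :
  has_ubound [set enorm (A *m v) | v in [set v : 'cV[R]_n | enorm v <= 1]].
Proof.
exists (Num.sqrt (\sum_(i < m) enorm (row i A)^T ^+ 2)) => _ [v /= v1 <-].
rewrite ler_sqrt; last by apply: sumr_ge0 => i _; rewrite sqr_ge0.
apply: ler_sum => i _; rewrite -real_normK ?num_real// ler_sqr ?nnegrE ?enorm_ge0//.
have -> : (A *m v) i 0 = \sum_(j < n) (row i A)^T j 0 * v j 0.
  by rewrite mxE; apply: eq_bigr => j _; rewrite !mxE.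
apply: (le_trans (cauchy_schwarz _ _)).
by rewrite ler_piMr// enorm_ge0.
Qed.

Lemma opnorm_ge0 (R : realType) m n (A : 'M[R]_(m, n)) : 0 <= opnorm A.
Proof.
apply: (ub_le_sup (has_ubound_opnorm A)); exists 0.
  by rewrite /= /enorm big1 ?sqrtr0// => i _; rewrite mxE expr0n.
by rewrite mulmx0 /enorm big1 ?sqrtr0// => i _; rewrite mxE expr0n.
Qed.

Lemma enorm_mulmx (R : realType) m n (A : 'M[R]_(m, n)) (v : 'cV[R]_n) :
  enorm (A *m v) <= opnorm A * enorm v.
Proof.
have [v0|v0] := eqVneq (enorm v) 0.
  rewrite v0 mulr0 (enorm_eq0 v0) mulmx0 /enorm big1 ?sqrtr0// => i _.
  by rewrite mxE expr0n.
have b0 : 0 < enorm v by rewrite lt_def v0 enorm_ge0.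
rewrite -ler_pdivrMr//.
have -> : enorm (A *m v) / enorm v = enorm (A *m ((enorm v)^-1 *: v)).
  by rewrite -scalemxAr enormZ ger0_norm ?invr_ge0 ?enorm_ge0// mulrC.
apply: (ub_le_sup (has_ubound_opnorm A)).
exists ((enorm v)^-1 *: v) => //=.
by rewrite enormZ ger0_norm ?invr_ge0 ?enorm_ge0// mulVf.
Qed.

Lemma bilinear_opnorm (R : realType) m n (A : 'M[R]_(m, n))
    (u : 'cV[R]_m) (v : 'cV[R]_n) :
  `|\sum_(i < m) \sum_(j < n) u i 0 * v j 0 * A i j| <=
  opnorm A * enorm u * enorm v.
Proof.
have -> : \sum_(i < m) \sum_(j < n) u i 0 * v j 0 * A i j =
    \sum_(i < m) u i 0 * (A *m v) i 0.
  apply: eq_bigr => i _; rewrite mxE mulr_sumr.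
  by apply: eq_bigr => j _; ring.
apply: (le_trans (cauchy_schwarz _ _)).
by rewrite mulrAC [leRHS]mulrC ler_wpM2l ?enorm_ge0 ?enorm_mulmx.
Qed.

(** * Directional derivatives *)

(** The form of the mean value theorem used throughout: with a monomial for g it
    integrates a bound on the derivative, and Taylor estimates follow by
    iterating it. *)
Lemma le_increment (R : realType) (f df g dg : R -> R) (a b : R) : a <= b ->
  (forall t, a <= t <= b -> is_derive t 1 f (df t)) ->
  (forall t, a <= t <= b -> is_derive t 1 g (dg t)) ->
  (forall t, a <= t <= b -> `|df t| <= dg t) ->
  `|f b - f a| <= g b - g a.
Proof.
move=> ab Hf Hg H.
have key (e : R) : e ^+ 2 = 1 -> e * (f b - f a) <= g b - g a.
  move=> e1.
  have dh t : a <= t <= b -> is_derive t 1 (fun x => g x - e * f x) (dg t - e * df t).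
    move=> tab; have := Hf t tab; have := Hg t tab => ? ?.
    exact: is_deriveB.
  have /= := @MVT_segment _ (fun x => g x - e * f x) (fun t => dg t - e * df t) a b ab.
  case.
  - move=> x; rewrite in_itv/= => /andP[ax xb]; apply: dh.
    by rewrite !ltW.
  - apply: derivable_within_continuous => x; rewrite in_itv/= => xab.
    by have := dh _ xab => -[].
  move=> c; rewrite in_itv/= => cab E.
  have : 0 <= (dg c - e * df c) * (b - a).
    rewrite mulr_ge0 ?subr_ge0//; apply: le_trans (H c cab).
    apply: (le_trans (ler_norm _)); rewrite normrM.
    have -> : `|e| = 1; last by rewrite mul1r.
    by apply/eqP; rewrite -sqrp_eq1// real_normK ?num_real// e1.
  rewrite -E; lra.
rewrite ler_norml lerNl; apply/andP; split.
  by rewrite -mulN1r key// sqrrN expr1n.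
by rewrite -[f b - f a]mul1r key// expr1n.
Qed.

(** Derivatives along a direction are one-variable derivatives along a line, so
    that estimates on segments reduce to the comparison lemma above. *)
Lemma is_derive_line (R : realType) (V : normedModType R) (F : V -> R) (x v : V) t d :
  is_derive (x + t *: v) v F d -> is_derive t 1 (fun t => F (x + t *: v)) d.
Proof.
move=> [dF Fd].
have E : (fun h : R => h^-1 *: (((fun t => F (x + t *: v)) \o shift t) (h *: 1) -
     F (x + t *: v))) =
  (fun h : R => h^-1 *: ((F \o shift (x + t *: v)) (h *: v) - F (x + t *: v))).
  apply/funext => h /=; congr (_ *: (F _ - _)).
  by rewrite [h *: 1]mulr1 scalerDl addrCA addrC [_ + h *: v]addrC addrC.
by split; [rewrite /derivable E|rewrite /derive E].
Qed.

Lemma is_derive_linear (R : realType) (c t : R) : is_derive t 1 (fun s : R => s * c) c.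
Proof.
have := @is_deriveM R R^o id (cst c) t 1 1 0 (is_derive_id _ _) (is_derive_cst _ _ _).
by move/is_derive_eq; apply; rewrite scaler0 add0r /GRing.scale/= mulr1.
Qed.

Lemma is_derive_monomial (R : realType) (C : R) (k : nat) (t : R) :
  is_derive t 1 (fun t : R => C * t ^+ k.+1) (C * (k.+1%:R * t ^+ k)).
Proof.
have -> : (fun t : R => C * t ^+ k.+1) = C *: ((@id R) ^+ k.+1).
  by apply/funext => x; rewrite /= !fctE.
apply: is_deriveZ; apply: is_derive_eq.
by rewrite /GRing.scale/= mulr1.
Qed.

(** The increment along v + c e is split into an increment along v and one along
    c e that starts at a nearby point; the second is controlled by the mean value
    inequality and the continuity of d2 at x. *)
Lemma is_derive_add_scale (R : realType) (V : normedModType R) (F d2 : V -> R)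
    (U : set V) (x v e : V) (c d1 : R) :
  open U -> U x ->
  (forall y, U y -> is_derive y e F (d2 y)) ->
  {for x, continuous d2} ->
  is_derive x v F d1 -> is_derive x (v + c *: e) F (d1 + c * d2 x).
Proof.
move=> oU Ux He cd2 [dF Fd].
suff H : h^-1 *: (F (h *: (v + c *: e) + x) - F x) @[h --> (0 : R)^'] --> d1 + c * d2 x.
  by split; [apply/cvg_ex; exists (d1 + c * d2 x)|exact: cvg_lim].
have H1 : h^-1 *: (F (h *: v + x) - F x) @[h --> (0 : R)^'] --> d1.
  by rewrite -Fd; exact: dF.
have H2 : h^-1 *: (F (h *: (v + c *: e) + x) - F (h *: v + x))
    @[h --> (0 : R)^'] --> c * d2 x.
  apply/cvgrPdist_le => eps eps0.
  have c1 : 0 < `|c| + 1 by rewrite ltr_wpDl.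
  have : \forall y \near x, U y /\ `|d2 x - d2 y| <= eps / (`|c| + 1).
    apply: filterI; first exact: open_nbhs_nbhs.
    by move/cvgrPdist_le : cd2; apply; rewrite divr_gt0.
  move/nbhs_ballP => [r /= r0 Hr].
  pose K := `|v| + `|c| * `|e| + 1.
  have K0 : 0 < K by rewrite ltr_wpDl// addr_ge0// mulr_ge0.
  near=> h.
  have h0 : h != 0 by near: h; exact: nbhs_dnbhs_neq.
  have hK : `|h| * K < r.
    rewrite -ltr_pdivlMr//; near: h; apply: dnbhs0_lt; exact: divr_gt0.
  have inball (s : R) : `|s| <= `|h * c| -> U (h *: v + x + s *: e) /\
      `|d2 x - d2 (h *: v + x + s *: e)| <= eps / (`|c| + 1).
    move=> sh; apply: Hr; rewrite -ball_normE /=; apply: le_lt_trans hK.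
    have -> : x - (h *: v + x + s *: e) = - (h *: v + s *: e).
      by rewrite [h *: v + x]addrC -addrA opprD addrA subrr sub0r.
    rewrite normrN (le_trans (ler_normD _ _))// !normrZ /K.
    rewrite -addrA mulrDr lerD// mulrDr mulr1.
    rewrite (@le_trans _ _ (`|h| * (`|c| * `|e|)))// ?lerDl// mulrA.
    by rewrite ler_wpM2r// -normrM.
  pose phi (s : R) := F (h *: v + x + s *: e) - s * d2 x.
  have dphi (s : R) : `|s| <= `|h * c| ->
      is_derive s 1 phi (d2 (h *: v + x + s *: e) - d2 x).
    move=> /inball[Us _].
    have /is_derive_line Hl := He _ Us.
    have Hm := is_derive_linear (d2 x) s.
    exact: is_deriveB.
  have dlin := is_derive_linear (eps / (`|c| + 1)).
  have main : `|phi (h * c) - phi 0| <= eps / (`|c| + 1) * `|h * c|.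
    have [hc|hc] := leP 0 (h * c).
      apply: le_trans (le_increment
        (df := fun s : R => d2 (h *: v + x + s *: e) - d2 x) hc _ (fun s _ => dlin s) _) _; last first.
      - by rewrite mul0r subr0 (ger0_norm hc) mulrC.
      - move=> s /andP[s0 s1]; rewrite distrC; apply: (inball s _).2.
        by rewrite !ger0_norm.
      - by move=> s /andP[s0 s1]; apply: dphi; rewrite !ger0_norm.
    rewrite distrC.
    apply: le_trans (le_increment
      (df := fun s : R => d2 (h *: v + x + s *: e) - d2 x) (ltW hc) _ (fun s _ => dlin s) _) _; last first.
    - by rewrite mul0r sub0r (ltr0_norm hc) mulrN mulrC.
    - move=> s /andP[s0 s1]; rewrite distrC; apply: (inball s _).2.
      by rewrite (ltr0_norm hc) ler0_norm// lerN2.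
    - move=> s /andP[s0 s1]; apply: dphi.
      by rewrite (ltr0_norm hc) ler0_norm// lerN2.
  have E : phi (h * c) - phi 0 =
     h * (h^-1 * (F (h *: (v + c *: e) + x) - F (h *: v + x)) - c * d2 x).
    have Ep : h *: v + x + (h * c) *: e = h *: (v + c *: e) + x.
      by rewrite scalerDr scalerA addrAC.
    by rewrite /phi scale0r addr0 mul0r subr0 Ep mulrBr mulVKf//; ring.
  rewrite distrC; rewrite -(@ler_pM2l _ `|h|) ?normr_gt0// -normrM -E.
  apply: (le_trans main); rewrite normrM mulrCA ler_wpM2l//.
  by rewrite -mulrA ler_piMr ?(ltW eps0)// ler_pdivrMl// mulr1 lerDl.
have -> : (fun h : R => h^-1 *: (F (h *: (v + c *: e) + x) - F x)) =
  (fun h => h^-1 *: (F (h *: v + x) - F x) +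
   h^-1 *: (F (h *: (v + c *: e) + x) - F (h *: v + x))).
  by apply/funext => h; rewrite -scalerDr [in RHS]addrC subrKA.
exact: cvgD.
Unshelve. all: by end_near. Qed.

(** Continuous partial derivatives give all directional derivatives: the
    coordinates of v are added one at a time. *)
Lemma is_derive_partial (R : realType) n (U : set 'cV[R]_n) (F : 'cV[R]_n -> R)
    (x v : 'cV[R]_n) :
  open U -> class_C 1 U F -> U x ->
  is_derive x v F (\sum_(i < n) v i 0 * partial i F x).
Proof.
move=> oU [_ H] Ux.
have -> : v = \sum_(i < n) v i 0 *: basis_vec R i.
  rewrite {1}[v]matrix_sum_delta; apply: eq_bigr => i _.
  by rewrite big_ord1.
have -> : (\sum_(i < n) (\sum_(j < n) v j 0 *: basis_vec R j) i 0 * partial i F x) =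
   \sum_(i < n) v i 0 * partial i F x.
   apply: eq_bigr => i _; congr (_ * _); rewrite summxE (bigD1 i)//= !mxE !eqxx mulr1.
   rewrite big1 ?addr0// => j ji; rewrite !mxE eq_sym (negbTE ji) mulr0//.
elim: (index_enum _) => [|i s IH].
  rewrite !big_nil.
  suff H1 : h^-1 *: (F (h *: 0 + x) - F x) @[h --> (0 : R)^'] --> (0 : R).
    by split; [apply/cvg_ex; exists 0|exact: cvg_lim].
  under eq_fun do rewrite scaler0 add0r subrr scaler0.
  exact: cvg_cst.
rewrite !big_cons addrC [X in is_derive _ _ _ X]addrC.
have K := @is_derive_add_scale R 'cV[R]_n F (partial i F) U x _ _ (v i 0) _ oU Ux _ _ IH; apply: K.
- by move=> y Uy; apply/derivableP/(H i).1.
- exact: (H i).2.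
Qed.

Lemma class_CS (R : realType) n k (U : set 'cV[R]_n) (f : 'cV[R]_n -> R) :
  class_C k.+1 U f -> class_C k U f.
Proof.
elim: k f => [|k IH] f [fc H]; first exact: fc.
split=> // i; have [di Ci] := H i; split=> //; exact: IH.
Qed.

Definition dirder (R : realType) n (f : 'cV[R]_n -> R) (v x : 'cV[R]_n) : R :=
  \sum_(i < n) v i 0 * partial i f x.

Definition hess_form (R : realType) n (f : 'cV[R]_n -> R) (x u v : 'cV[R]_n) : R :=
  \sum_(i < n) \sum_(j < n) u i 0 * v j 0 * hessian f x i j.

(** * Functions with a Lipschitz Hessian *)

Section lipschitz_hessian.
Variables (R : realType) (n : nat) (r : R) (x0 : 'cV[R]_n)
  (f : 'cV[R]_n -> R) (U : set 'cV[R]_n) (L : R).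
Hypotheses (oU : open U) (bU : eball x0 r `<=` U) (fC : class_C 2 U f)
  (fL : lipschitz_hessian f (eball x0 r) L).

Lemma is_derive_dirder x v : U x -> is_derive x v f (dirder f v x).
Proof. by move=> Ux; apply: (is_derive_partial _ oU) => //; exact: class_CS. Qed.

Lemma is_derive2_dirder x v w : U x ->
  is_derive x w (dirder f v) (hess_form f x w v).
Proof.
move=> Ux.
have -> : dirder f v = \sum_(j < n) (fun x => v j 0 * partial j f x).
  by apply/funext => y; rewrite fct_sumE.
rewrite /hess_form exchange_big/=.
apply: is_derive_sum => j.
have -> : \sum_(i < n) w i 0 * v j 0 * hessian f x i j =
   v j 0 *: \sum_(i < n) w i 0 * partial i (partial j f) x.
  by rewrite [RHS]mulr_sumr; apply: eq_bigr => i _; rewrite mxE; ring.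
apply: is_deriveZ; apply: (is_derive_partial _ oU) => //; exact: (fC.2 j).2.
Qed.

Lemma hess_form_lipschitz x y u v : eball x0 r x -> eball x0 r y ->
  `|hess_form f x u v - hess_form f y u v| <=
  L * enorm (x - y) * enorm u * enorm v.
Proof.
move=> bx by_.
have -> : hess_form f x u v - hess_form f y u v = \sum_(i < n) \sum_(j < n)
   u i 0 * v j 0 * (hessian f x - hessian f y) i j.
  rewrite -sumrB; apply: eq_bigr => i _; rewrite -sumrB; apply: eq_bigr => j _.
  by rewrite -mulrBr !mxE.
apply: (le_trans (bilinear_opnorm _ _ _)).
by rewrite !ler_wpM2r ?enorm_ge0// fL.
Qed.

Lemma lipschitz_hessian_ge0 : (0 < n)%N -> 0 < r -> 0 <= L.
Proof.
move=> n0 r0; pose e := r *: basis_vec R (Ordinal n0).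
have Ee : enorm e = r.
  rewrite enormZ gtr0_norm// /enorm (bigD1 (Ordinal n0))//= !mxE !eqxx expr1n.
  rewrite big1 ?addr0 ?sqrtr1 ?mulr1// => i.
  by rewrite !mxE => /negbTE ->; rewrite expr0n.
have b0 : eball x0 r x0.
  rewrite /eball/= subrr /enorm big1 ?sqrtr0 ?ltW// => i _.
  by rewrite mxE expr0n.
have b1 : eball x0 r (x0 + e) by rewrite /eball/= addrAC subrr add0r Ee.
have := le_trans (opnorm_ge0 _) (fL b1 b0).
by rewrite addrAC subrr add0r Ee pmulr_lge0.
Qed.

(** The second derivative along the segment from x0 to x0 + v moves by at most
    L |v|^3 t at time t; integrating t twice produces the factor 1/6. *)
Lemma taylor2_remainder v : enorm v <= r ->
  `|f (x0 + v) - f x0 - dirder f v x0 - hess_form f x0 v v / 2| <=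
  L / 6 * enorm v ^+ 3.
Proof.
move=> vr.
have inb (t : R) : 0 <= t <= 1 -> eball x0 r (x0 + t *: v).
  move=> /andP[t0 t1]; rewrite /eball/= addrAC subrr add0r enormZ ger0_norm//.
  by apply: le_trans vr; rewrite ler_piMl ?enorm_ge0.
have d1 (t : R) : 0 <= t <= 1 -> is_derive t 1 (fun t => f (x0 + t *: v)) (dirder f v (x0 + t *: v)).
  by move=> /inb/bU/is_derive_dirder => /(_ v)/is_derive_line.
have d2 (t : R) : 0 <= t <= 1 ->
    is_derive t 1 (fun t => dirder f v (x0 + t *: v)) (hess_form f (x0 + t *: v) v v).
  by move=> /inb/bU/is_derive2_dirder => /(_ v v)/is_derive_line.
pose g1 (t : R) := dirder f v (x0 + t *: v) - t * hess_form f x0 v v.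
have b1 (t : R) : 0 <= t <= 1 -> `|g1 t - g1 0| <= L * enorm v ^+ 3 / 2 * t ^+ 2.
  move=> /andP[t0 t1].
  have := @le_increment R g1 (fun t => hess_form f (x0 + t *: v) v v - hess_form f x0 v v)
    (fun t => L * enorm v ^+ 3 / 2 * t ^+ 2) _ 0 t t0 _ (fun t _ => is_derive_monomial _ _ t).
  rewrite expr0n mulr0 subr0; apply.
  - move=> s /andP[s0 st]; apply: is_deriveB.
      by apply: d2; rewrite s0 (le_trans st).
    exact: is_derive_linear.
  - move=> s /andP[s0 st].
    have s01 : 0 <= s <= 1 by rewrite s0 (le_trans st).
    have /= := hess_form_lipschitz v v (inb _ s01) (inb 0 _).
    rewrite scale0r addr0 lexx ler01 => /(_ isT)/le_trans; apply.
    rewrite addrAC subrr add0r enormZ ger0_norm// le_eqVlt; apply/orP; left.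
    by apply/eqP; field.
pose g0 (t : R) := f (x0 + t *: v) - t * dirder f v x0 - hess_form f x0 v v / 2 * t ^+ 2.
have := @le_increment R g0 (fun t => g1 t - g1 0)
    (fun t => L * enorm v ^+ 3 / 6 * t ^+ 3) _ 0 1 ler01 _ (fun t _ => is_derive_monomial _ _ t).
rewrite expr0n mulr0 subr0 expr1n mulr1.
have -> : g0 1 - g0 0 = f (x0 + v) - f x0 - dirder f v x0 - hess_form f x0 v v / 2.
  rewrite /g0 scale1r scale0r addr0; ring.
rewrite -[L / 6 * _]mulrAC; apply.
- move=> t t01.
  have -> : g1 t - g1 0 = dirder f v (x0 + t *: v) - dirder f v x0 -
     hess_form f x0 v v / 2 * (2 * t ^+ 1).
     by rewrite /g1 scale0r addr0; field.
  apply: is_deriveB; last exact: (is_derive_monomial _ 1 t).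
  apply: is_deriveB; last exact: is_derive_linear.
  exact: d1.
- move=> t t01; apply: (le_trans (b1 t t01)).
  by rewrite le_eqVlt; apply/orP; left; apply/eqP; field.
Qed.

(** The part of f (x0 + (u + w)) that is odd in u and even in w, that is, what is
    left of f when it is averaged, against a function odd in u and even in w,
    over the sign changes of u and w. *)
Definition odd_part (u w : 'cV[R]_n) : R :=
  (f (x0 + (u + w)) - f (x0 + (- u + w)) + f (x0 + (u - w)) - f (x0 + (- u - w))) / 4.

(** The points u + w and - u - w have the same quadratic Taylor term and enter
    with opposite signs, and likewise u - w and - u + w: only the linear term in
    u survives, with the mean of four remainders. *)
Lemma odd_part_taylor (u w : 'cV[R]_n) : \sum_(i < n) u i 0 * w i 0 = 0 ->
  enorm (u + w) <= r ->
  `|odd_part u w - dirder f u x0| <= L / 6 * enorm (u + w) ^+ 3.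
Proof.
move=> uw uwr.
have E : enorm (- u + w) = enorm (u + w).
  apply/eqP; rewrite -(@eqrXn2 _ 2)// ?enorm_ge0//.
  have := enormDorth (-1) 1 uw; rewrite scaleN1r scale1r => ->.
  have := enormDorth 1 1 uw; rewrite !scale1r => ->.
  by rewrite sqrrN.
have E2 : enorm (u - w) = enorm (u + w) by rewrite -enormN opprB addrC E.
have E3 : enorm (- u - w) = enorm (u + w) by rewrite -opprD enormN.
have h1 := taylor2_remainder uwr.
have := @taylor2_remainder (- u + w); rewrite E => /(_ uwr).
have := @taylor2_remainder (u - w); rewrite E2 => /(_ uwr).
have := @taylor2_remainder (- u - w); rewrite E3 => /(_ uwr).
have dD a b : dirder f (a + b) x0 = dirder f a x0 + dirder f b x0.
  by rewrite /dirder -big_split/=; apply: eq_bigr => i _; rewrite mxE mulrDl.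
have dN a : dirder f (- a) x0 = - dirder f a x0.
  by rewrite /dirder -sumrN; apply: eq_bigr => i _; rewrite mxE mulNr.
have hN a : hess_form f x0 (- a) (- a) = hess_form f x0 a a.
  rewrite /hess_form; apply: eq_bigr => i _; apply: eq_bigr => j _.
  by rewrite !mxE mulrNN.
have hN1 : hess_form f x0 (- u - w) (- u - w) = hess_form f x0 (u + w) (u + w).
  by rewrite -opprD hN.
have hN2 : hess_form f x0 (- u + w) (- u + w) = hess_form f x0 (u - w) (u - w).
  by rewrite -hN opprD opprK.
rewrite hN1 hN2 /odd_part; move: h1; rewrite !dD !dN !ler_norml.
move=> /andP[? ?] /andP[? ?] /andP[? ?] /andP[? ?].
apply/andP; split; lra.
Qed.

(** The derivative of the odd part with respect to the size s of w is a mixed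
    second difference of f; only the variation of the Hessian between t u + s w
    and t u - s w enters, of size 2 s |w|, and both u and w factor out. *)
Lemma odd_part_diff (u w : 'cV[R]_n) (l : R) :
  \sum_(i < n) u i 0 * w i 0 = 0 -> enorm (u + w) <= r -> 0 <= l <= 1 ->
  `|odd_part u w - odd_part u (l *: w)| <=
  L / 2 * enorm u * enorm w ^+ 2 * (1 - l ^+ 2).
Proof.
move=> uw uwr /andP[l0 l1].
have inb (s t : R) : `|s| <= 1 -> `|t| <= 1 -> eball x0 r ((x0 + s *: u) + t *: w).
  move=> s1 t1; rewrite /eball/= addrAC [_ - x0]addrAC subrr add0r.
  apply: le_trans uwr; rewrite -(@ler_pXn2r _ 2)// ?nnegrE ?enorm_ge0//.
  have := enormDorth 1 1 uw; rewrite !scale1r => ->.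
  rewrite enormDorth// expr1n; apply: lerD; rewrite ler_wpM2r ?sqr_ge0//.
    by rewrite -real_normK ?num_real// expr_le1.
  by rewrite -real_normK ?num_real// expr_le1.
have dinner (s t d : R) : `|s| <= 1 -> `|t| <= 1 -> `|d| = 1 ->
  is_derive t 1 (fun t => f ((x0 + s *: u) + t *: (d *: w)))
    (d * dirder f w ((x0 + s *: u) + t *: (d *: w))).
  move=> s1 t1 d1.
  have td : `|t * d| <= 1 by rewrite normrM d1 mulr1.
  have := inb _ _ s1 td; rewrite -scalerA => /bU Ux.
  have := is_derive_line (is_derive_dirder (d *: w) Ux).
  move/is_derive_eq; apply; rewrite /dirder mulr_sumr; apply: eq_bigr => i _.
  by rewrite !mxE mulrA.
pose E (s t : R) := dirder f w (x0 + s *: u + t *: w).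
have mixed (t : R) : 0 <= t <= 1 ->
    `|(E 1 t - E 1 (- t)) - (E (-1) t - E (-1) (- t))| <=
    4 * L * enorm u * enorm w ^+ 2 * t.
  move=> /andP[t0 t1].
  have at1 : `|t| <= 1 by rewrite ger0_norm.
  have an1 : `|- t| <= 1 by rewrite normrN.
  have dE (s b : R) : `|s| <= 1 -> `|b| <= 1 ->
      is_derive s 1 (fun s => E s b) (hess_form f (x0 + s *: u + b *: w) u w).
    move=> s1 b1; have := inb _ _ s1 b1; rewrite addrAC => /bU Ux.
    have := is_derive_line (is_derive2_dirder w u Ux).
    rewrite [_ + b *: w + _]addrAC => /is_derive_eq.
    have -> : (fun s => E s b) = (fun s => dirder f w (x0 + b *: w + s *: u)).
      by apply/funext => z; rewrite /E addrAC.
    exact.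
  have le11 : (-1 : R) <= 1 by lra.
  have abs1 (s : R) : -1 <= s <= 1 -> `|s| <= 1 by rewrite ler_norml.
  have := @le_increment R (fun s => E s t - E s (- t)) (fun s =>
      hess_form f (x0 + s *: u + t *: w) u w -
      hess_form f (x0 + s *: u + (- t) *: w) u w) _ _ (-1) 1 le11 _
     (fun s _ => is_derive_linear (2 * L * enorm u * enorm w ^+ 2 * t) s).
  have -> : 1 * (2 * L * enorm u * enorm w ^+ 2 * t) -
    -1 * (2 * L * enorm u * enorm w ^+ 2 * t) = 4 * L * enorm u * enorm w ^+ 2 * t.
    by ring.
  apply.
  - by move=> s /abs1 s1; apply: is_deriveB; exact: dE.
  - move=> s /abs1 s1.
    apply: (le_trans (hess_form_lipschitz _ _ (inb _ _ s1 at1) (inb _ _ s1 an1))).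
    have -> : x0 + s *: u + t *: w - (x0 + s *: u + - t *: w) = (2 * t) *: w.
      by rewrite opprD addrACA subrr add0r scaleNr opprK mulr_natl -scalerDl.
    rewrite enormZ ger0_norm ?mulr_ge0//.
    by rewrite le_eqVlt; apply/orP; left; apply/eqP; ring.
pose q (s : R) := odd_part u (s *: w).
pose dq (s : R) := ((E 1 s - E 1 (- s)) - (E (-1) s - E (-1) (- s))) / 4.
have qE s : q s = (f (x0 + 1 *: u + s *: (1 *: w)) - f (x0 + (-1) *: u + s *: (1 *: w))
    + f (x0 + 1 *: u + s *: (-1 *: w)) - f (x0 + (-1) *: u + s *: (-1 *: w))) / 4.
  by rewrite /q /odd_part !scale1r !scaleN1r !scalerN !addrA.
have dqE (s : R) : l <= s <= 1 -> is_derive s 1 q (dq s).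
  move=> /andP[ls s1].
  have as1 : `|s| <= 1 by rewrite ger0_norm// (le_trans l0).
  have n1 : `|(1 : R)| <= 1 by rewrite normr1.
  have nN1 : `|(- 1 : R)| <= 1 by rewrite normrN1.
  have e1 : `|(1 : R)| = 1 by rewrite normr1.
  have eN1 : `|(- 1 : R)| = 1 by rewrite normrN1.
  have D1 := dinner _ _ _ n1 as1 e1.
  have D2 := dinner _ _ _ nN1 as1 e1.
  have D3 := dinner _ _ _ n1 as1 eN1.
  have D4 := dinner _ _ _ nN1 as1 eN1.
  have -> : q = (4^-1 : R) *: ((fun s : R => f (x0 + 1 *: u + s *: (1 *: w))) -
     (fun s : R => f (x0 + (-1) *: u + s *: (1 *: w)))
    + (fun s : R => f (x0 + 1 *: u + s *: (-1 *: w))) -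
    (fun s : R => f (x0 + (-1) *: u + s *: (-1 *: w)))).
    by apply/funext => z; rewrite qE mulrC.
  apply: is_derive_eq.
  rewrite /dq /E !scale1r !scaleN1r !scalerN !scaleNr !mul1r !mulN1r opprK.
  by rewrite [LHS]mulrC; congr (_ / _); ring.
have := le_increment l1 dqE (g := fun s => L / 2 * enorm u * enorm w ^+ 2 * s ^+ 2)
  (dg := fun s => L / 2 * enorm u * enorm w ^+ 2 * (2 * s)).
have -> : q 1 - q l = odd_part u w - odd_part u (l *: w) by rewrite /q scale1r.
have -> : L / 2 * enorm u * enorm w ^+ 2 * 1 ^+ 2 - L / 2 * enorm u * enorm w ^+ 2 * l ^+ 2
  = L / 2 * enorm u * enorm w ^+ 2 * (1 - l ^+ 2) by ring.
apply.
- by move=> s _; exact: (is_derive_monomial _ 1 s).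
- move=> s /andP[ls s1].
  have s01 : 0 <= s <= 1 by rewrite (le_trans l0 ls).
  have := mixed _ s01; rewrite /dq normrM [`|4^-1|]ger0_norm ?invr_ge0// => h.
  by rewrite ler_pdivrMr//; apply: (le_trans h); rewrite le_eqVlt; apply/orP; left;
    apply/eqP; field.
Qed.

End lipschitz_hessian.

(** Here c = |u| / rho.  If c >= 1/2, the Taylor bound is used at u + w.  Otherwise
    w is first shrunk to the length sqrt 3 |u|; the Taylor bound at the new point,
    of norm 2 |u|, and the cost of shrinking add up to (L/6) rho^3 (3c - 4c^3).
    The polynomial in the conclusion is a common majorant of c on [1/2, 1] and of
    3c^2 - 4c^4 that only involves even powers of c, whose means are explicit. *)
Lemma odd_part_bound (R : realType) (n : nat) (r : R) (x0 : 'cV[R]_n)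
    (f : 'cV[R]_n -> R) (U : set 'cV[R]_n) (L rho c : R) (u w : 'cV[R]_n) :
  open U -> eball x0 r `<=` U -> class_C 2 U f ->
  lipschitz_hessian f (eball x0 r) L -> 0 <= L ->
  \sum_(i < n) u i 0 * w i 0 = 0 -> 0 <= c -> 0 <= rho <= r ->
  enorm u = rho * c -> enorm (u + w) = rho ->
  enorm u * `|odd_part x0 f u w - dirder f u x0| <=
  L / 6 * rho ^+ 4 * (3 * c ^+ 2 - 7 / 2 * c ^+ 4 + 3 / 2 * c ^+ 6).
Proof.
move=> oU bU fC fL L0 uw c0 /andP[rho0 rhor] Eu Euw.
have pyth : rho ^+ 2 = (rho * c) ^+ 2 + enorm w ^+ 2.
  by rewrite -Eu -Euw; have := enormDorth 1 1 uw; rewrite !scale1r expr1n !mul1r.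
have [rho_0|rhoN0] := eqVneq rho 0.
  by rewrite Eu rho_0 mul0r mul0r expr0n mulr0 mul0r.
have rho_gt0 : 0 < rho by rewrite lt_def rhoN0.
have c1 : c <= 1.
  have : (rho * c) ^+ 2 <= rho ^+ 2 by rewrite [leRHS]pyth lerDl sqr_ge0.
  by rewrite ler_pXn2r ?nnegrE ?mulr_ge0// ger_pMr.
have uwr : enorm (u + w) <= r by rewrite Euw.
have [chalf|chalf] := leP 2^-1 c.
  have := odd_part_taylor oU bU fC fL uw uwr; rewrite Euw.
  set D := `|_| => hD; rewrite Eu.
  apply: (@le_trans _ _ (L / 6 * rho ^+ 4 * c)).
    have -> : L / 6 * rho ^+ 4 * c = rho * c * (L / 6 * rho ^+ 3) by ring.
    by rewrite ler_wpM2l// mulr_ge0.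
  rewrite ler_wpM2l ?mulr_ge0 ?exprn_ge0 ?invr_ge0//.
  (* the majorant touches c to second order at c = 1, hence the square *)
  have -> : 3 * c ^+ 2 - 7 / 2 * c ^+ 4 + 3 / 2 * c ^+ 6 =
    c + c * ((1 - c) ^+ 2 * (3 / 2 * c ^+ 3 + 3 * c ^+ 2 + (c - 1))) by field.
  rewrite lerDl mulr_ge0// mulr_ge0 ?sqr_ge0//.
  have c3 : 0 <= 3 / 2 * c ^+ 3 by rewrite mulr_ge0 ?exprn_ge0.
  have c2 : 2^-1 <= c ^+ 2 * 2 by nra.
  lra.
set b := enorm w in pyth.
have b2 : b ^+ 2 = rho ^+ 2 * (1 - c ^+ 2).
  by rewrite mulrBr mulr1 [X in _ = X - _]pyth exprMn; ring.
have b2_gt : 3 * (rho * c) ^+ 2 < b ^+ 2.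
  have rr : 0 < rho ^+ 2 by rewrite exprn_gt0.
  rewrite b2 exprMn mulrCA ltr_pM2l//.
  have := ltr_pM c0 c0 chalf chalf; rewrite expr2; lra.
have b_gt0 : 0 < b.
  rewrite lt_def enorm_ge0 andbT; apply/eqP => b0; move: b2_gt.
  by rewrite b0 expr0n/=; have := sqr_ge0 (rho * c); lra.
(* shrinking w to the length sqrt 3 |u| minimizes the sum of the two bounds *)
pose l := Num.sqrt 3 * (rho * c) / b.
have l2 : l ^+ 2 * b ^+ 2 = 3 * (rho * c) ^+ 2.
  by rewrite -exprMn /l divfK ?gt_eqF// exprMn sqr_sqrtr.
have l0 : 0 <= l by rewrite /l !mulr_ge0 ?sqrtr_ge0// invr_ge0 ltW.
have l1 : l <= 1.
  rewrite -(@expr_le1 _ 2)//.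
  have bb : 0 < b ^+ 2 by rewrite exprn_gt0.
  by rewrite -(ler_pM2r bb) l2 mul1r ltW.
have ul : \sum_(i < n) u i 0 * (l *: w) i 0 = 0.
  transitivity (l * \sum_(i < n) u i 0 * w i 0); last by rewrite uw mulr0.
  by rewrite mulr_sumr; apply: eq_bigr => i _; rewrite mxE; ring.
have Eul : enorm (u + l *: w) = 2 * (rho * c).
  apply/eqP; rewrite -(@eqrXn2 _ 2)// ?enorm_ge0 ?mulr_ge0//.
  have := enormDorth 1 l uw; rewrite scale1r => ->.
  by rewrite -/b l2 Eu; apply/eqP; ring.
have ulr : enorm (u + l *: w) <= r.
  apply: le_trans rhor; rewrite Eul mulrCA ler_piMr//; lra.
have T := odd_part_taylor oU bU fC fL ul ulr.
have l01 : 0 <= l <= 1 by rewrite l0.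
have M := odd_part_diff oU bU fC fL uw uwr l01.
have -> : odd_part x0 f u w - dirder f u x0 =
  (odd_part x0 f u w - odd_part x0 f u (l *: w)) +
  (odd_part x0 f u (l *: w) - dirder f u x0) by rewrite addrA subrK.
have := le_trans (ler_normD _ _) (lerD M T).
set D := `|_| => hD; rewrite Eul Eu -/b in hD *.
apply: (@le_trans _ _ (L / 6 * rho ^+ 4 * (3 * c ^+ 2 - 4 * c ^+ 4))).
  have -> : L / 6 * rho ^+ 4 * (3 * c ^+ 2 - 4 * c ^+ 4) =
    rho * c * (L / 6 * rho ^+ 3 * (3 * c - 4 * c ^+ 3)) by ring.
  rewrite ler_wpM2l ?mulr_ge0//; apply: (le_trans hD).
  have -> : L / 2 * (rho * c) * b ^+ 2 * (1 - l ^+ 2) =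
    L / 2 * (rho * c) * (b ^+ 2 - l ^+ 2 * b ^+ 2) by ring.
  by rewrite l2 b2 le_eqVlt; apply/orP; left; apply/eqP; field.
rewrite ler_wpM2l ?mulr_ge0 ?exprn_ge0 ?invr_ge0//.
have c4 : 0 <= c ^+ 4 by rewrite exprn_ge0.
have c6 : 0 <= c ^+ 6 by rewrite exprn_ge0.
lra.
Qed.

(** Being Lipschitz, the Hessian is bounded on the ball; hence so is the gradient,
    and f is Lipschitz.  This is what makes the sampled functions uniformly
    continuous. *)
Lemma lipschitz_on_ball (R : realType) (n : nat) (r : R) (x0 : 'cV[R]_n)
    (f : 'cV[R]_n -> R) (U : set 'cV[R]_n) (L : R) :
  open U -> eball x0 r `<=` U -> class_C 2 U f ->
  lipschitz_hessian f (eball x0 r) L -> 0 <= L -> 0 <= r ->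
  exists2 K, 0 <= K & forall x y, enorm x <= r -> enorm y <= r ->
    `|f (x0 + x) - f (x0 + y)| <= K * enorm (x - y).
Proof.
move=> oU bU fC fL L0 r0.
have inb x : enorm x <= r -> eball x0 r (x0 + x).
  by rewrite /eball/= addrAC subrr add0r.
pose c := opnorm (hessian f x0); pose g := enorm (grad f x0).
have c0 : 0 <= c by exact: opnorm_ge0.
have g0 : 0 <= g by exact: enorm_ge0.
have hb x a v : enorm x <= r ->
    `|hess_form f (x0 + x) a v| <= (L * r + c) * enorm a * enorm v.
  move=> xr; rewrite -[hess_form f _ a v](subrK (hess_form f x0 a v)).
  apply: (le_trans (ler_normD _ _)); rewrite 2!mulrDl; apply: lerD.
    have b0 : eball x0 r x0.
      rewrite /eball/= subrr /enorm big1 ?sqrtr0// => i _.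
      by rewrite mxE expr0n.
    apply: (le_trans (hess_form_lipschitz fL a v (inb _ xr) b0)).
    by rewrite !ler_wpM2r ?enorm_ge0// ler_wpM2l// addrAC subrr add0r.
  exact: bilinear_opnorm.
have gb x v : enorm x <= r -> `|dirder f v (x0 + x)| <= ((L * r + c) * r + g) * enorm v.
  move=> xr; rewrite -[dirder f v _](subrK (dirder f v x0)).
  apply: (le_trans (ler_normD _ _)); rewrite mulrDl; apply: lerD.
    have tx (t : R) : 0 <= t <= 1 -> enorm (t *: x) <= r.
      move=> /andP[t0 t1]; rewrite enormZ ger0_norm//.
      by apply: le_trans xr; rewrite ler_piMl ?enorm_ge0.
    have := @le_increment R (fun t => dirder f v (x0 + t *: x))
      (fun t => hess_form f (x0 + t *: x) x v) _ _ 0 1 ler01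
      (fun t t01 => is_derive_line (is_derive2_dirder oU fC v x (bU _ (inb _ (tx t t01)))))
      (fun t _ => is_derive_linear ((L * r + c) * r * enorm v) t).
    rewrite scale1r scale0r addr0 mul1r mul0r subr0; apply => t t01.
    apply: (le_trans (hb _ _ _ (tx t t01))).
    by rewrite ler_wpM2r ?enorm_ge0// ler_wpM2l// addr_ge0// mulr_ge0.
  rewrite mulrC; have := cauchy_schwarz v (grad f x0).
  rewrite /dirder; apply: le_trans.
  by rewrite le_eqVlt; apply/orP; left; apply/eqP; congr `|_|; apply: eq_bigr => i _; rewrite mxE.
exists ((L * r + c) * r + g).
  by rewrite addr_ge0// mulr_ge0// addr_ge0// mulr_ge0.
move=> x y xr yr; pose v := x - y.
have ty (t : R) : 0 <= t <= 1 -> enorm (y + t *: v) <= r.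
  move=> /andP[t0 t1].
  have -> : y + t *: v = t *: x + (1 - t) *: y.
    by rewrite /v scalerBr scalerBl scale1r addrCA.
  apply: (le_trans (enormD _ _)); rewrite !enormZ !ger0_norm ?subr_ge0//.
  have -> : r = t * r + (1 - t) * r by ring.
  by rewrite lerD// ler_wpM2l// subr_ge0.
have dl (t : R) : 0 <= t <= 1 -> is_derive t 1 (fun t => f (x0 + y + t *: v)) (dirder f v (x0 + (y + t *: v))).
  move=> t01; have := bU _ (inb _ (ty t t01)); rewrite addrA => Ux.
  exact: is_derive_line (is_derive_dirder oU fC v Ux).
have := @le_increment R (fun t => f (x0 + y + t *: v))
  (fun t => dirder f v (x0 + (y + t *: v))) _ _ 0 1 ler01 dl
  (fun t _ => is_derive_linear (((L * r + c) * r + g) * enorm v) t).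
rewrite scale1r scale0r addr0 mul1r mul0r subr0.
have -> : x0 + y + v = x0 + x by rewrite /v -addrA [y + _]addrC subrK.
by apply => t t01; exact: gb (ty t t01).
Qed.

(** * Riemann sums on a box *)

Definition midpoint (R : realType) n (D : 'I_n -> R) m (z : {ffun 'I_n -> 'I_m}) :
  'I_n -> R := fun i => ((z i)%:R + 2^-1) * (D i / m%:R).

Definition midpoint_mean (R : realType) n (D : 'I_n -> R) m (G : ('I_n -> R) -> R) : R :=
  (\sum_(z : {ffun 'I_n -> 'I_m}) G (midpoint D z)) / (m ^ n)%:R.

Definition box_close (R : realType) n (D : 'I_n -> R) (G : ('I_n -> R) -> R)
    (delta eps : R) := forall s t : 'I_n -> R,
  (forall i, 0 <= s i <= D i) -> (forall i, 0 <= t i <= D i) ->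
  (forall i, `|s i - t i| <= delta) -> `|G s - G t| <= eps.

Definition uniformly_close (R : realType) n (D : 'I_n -> R) (G : ('I_n -> R) -> R) :=
  forall eps, 0 < eps -> exists2 delta, 0 < delta & box_close D G delta eps.

Section midpoint_mean_theory.
Variables (R : realType) (n : nat) (D : 'I_n -> R) (m : nat).
Implicit Types G H : ('I_n -> R) -> R.

Lemma midpoint_meanD G H :
  midpoint_mean D m (fun t => G t + H t) = midpoint_mean D m G + midpoint_mean D m H.
Proof. by rewrite /midpoint_mean big_split mulrDl. Qed.

Lemma midpoint_meanZ (a : R) G :
  midpoint_mean D m (fun t => a * G t) = a * midpoint_mean D m G.
Proof. by rewrite /midpoint_mean -mulr_sumr mulrA. Qed.

Lemma midpoint_mean_le G H :
  (forall z, `|G (@midpoint R n D m z)| <= H (midpoint D z)) ->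
  `|midpoint_mean D m G| <= midpoint_mean D m H.
Proof.
move=> GH; rewrite /midpoint_mean normrM [`|_^-1|]ger0_norm ?invr_ge0//.
rewrite ler_wpM2r ?invr_ge0//; apply: (le_trans (ler_norm_sum _ _ _)).
exact: ler_sum.
Qed.

End midpoint_mean_theory.

Lemma midpoint_tagged (R : realType) n (D : 'I_n -> R) m (z : {ffun 'I_n -> 'I_m}) i :
  0 <= D i -> (z i)%:R * (D i / m%:R) <= midpoint D z i <= (z i).+1%:R * (D i / m%:R).
Proof.
move=> D0; have Dm : 0 <= D i / m%:R by rewrite divr_ge0.
rewrite /midpoint !ler_wpM2r//; last by rewrite lerDl invr_ge0.
by rewrite -[leRHS]natr1; lra.
Qed.

Lemma midpoint_in_box (R : realType) n (D : 'I_n -> R) m (z : {ffun 'I_n -> 'I_m}) i :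
  0 <= D i -> 0 <= midpoint D z i <= D i.
Proof.
move=> D0; have := midpoint_tagged z D0.
have m0 : (0 < m)%N by rewrite (leq_trans _ (ltn_ord (z i))).
have DN : 0 <= D i / m%:R by rewrite divr_ge0.
move=> /andP[s1 s2]; rewrite (le_trans _ s1) ?mulr_ge0//=.
apply: (le_trans s2); rewrite mulrCA ler_piMr// ler_pdivrMr ?ltr0n// mul1r ler_nat.
exact: ltn_ord.
Qed.

Lemma card_divn_eq m q N (y : 'I_N) : (0 < q)%N -> m = (N * q)%N ->
  #|[set a : 'I_m | (a %/ q)%N == y]%SET| = q.
Proof.
move=> q0 mE.
have lt_m (w : 'I_q) : (y * q + w < m)%N.
  rewrite mE (@leq_trans (y.+1 * q))//; first by rewrite mulSn addnC ltn_add2r.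
  by rewrite leq_mul2r ltn_ord orbT.
have -> : ([set a : 'I_m | (a %/ q)%N == y] = [set Ordinal (lt_m w) | w in [set: 'I_q]])%SET.
  apply/setP => a; rewrite inE; apply/eqP/imsetP => [ay|[w _ ->] /=].
    have aq : (a %% q < q)%N by rewrite ltn_mod.
    exists (Ordinal aq) => //; apply: val_inj => /=.
    by rewrite -ay -divn_eq.
  by rewrite divnMDl// divn_small ?addn0.
rewrite card_imset ?cardsT ?card_ord// => w1 w2 [] /addnI /val_inj//.
Qed.

(** Both means are taken over the fine midpoint grid: each coarse cell contains the
    same number of fine midpoints, so the mean over the coarse tags does not change
    when the tag of a cell is repeated once for each of them.  Corresponding points
    then lie in a common coarse cell. *)
Lemma tagged_mean_midpoint (R : realType) n (D : 'I_n -> R) (N : 'I_n -> nat)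
    (J : finType) (Y : J -> {dffun forall i : 'I_n, 'I_(N i)}) (T : J -> 'I_n -> R)
    (G : ('I_n -> R) -> R) (delta eps : R) (k m : nat) :
  (forall i, 0 <= D i) -> (forall i, 0 < N i)%N -> (0 < k)%N ->
  m = (k * \prod_(i < n) N i)%N ->
  bijective Y ->
  (forall j i, (Y j i)%:R * (D i / (N i)%:R) <= T j i <=
               (Y j i).+1%:R * (D i / (N i)%:R)) ->
  (forall i, D i / (N i)%:R <= delta) -> box_close D G delta eps ->
  `|(\sum_j G (T j)) / (\prod_(i < n) N i)%:R - midpoint_mean D m G| <= eps.
Proof.
move=> D0 N0 k0 mE [Yi YK YiK] TY Ndelta Gde.
have P0 : (0 < \prod_(i < n) N i)%N by apply: prodn_gt0.
have m0 : (0 < m)%N by rewrite mE muln_gt0 k0.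
pose q i := (m %/ N i)%N.
have mq i : m = (N i * q i)%N.
  by rewrite mulnC /q divnK// mE dvdn_mull// (bigD1 i)//= dvdn_mulr.
have q0 i : (0 < q i)%N by move: m0; rewrite (mq i) muln_gt0 => /andP[].
have lt_cell (z : {ffun 'I_n -> 'I_m}) i : (z i %/ q i < N i)%N.
  by rewrite ltn_divLR// -mq.
pose cell z : {dffun forall i : 'I_n, 'I_(N i)} := [ffun i => Ordinal (lt_cell z i)].
have card_cell y : #|[set z | cell z == y]%SET| = (\prod_(i < n) q i)%N.
  pose A (i : 'I_n) := [set a : 'I_m | (a %/ q i)%N == y i]%SET.
  transitivity #|family A|.
    rewrite -[RHS]cardsE; apply: eq_card => z; rewrite !inE.
    apply/eqP/familyP => [e i|zA]; first by rewrite inE -e ffunE.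
    by apply/ffunP => i; apply: val_inj; have := zA i; rewrite inE ffunE => /eqP.
  rewrite card_family foldrE big_map big_enum/=; apply: eq_bigr => i _.
  by rewrite card_divn_eq.
have sum_cell (h : {dffun forall i : 'I_n, 'I_(N i)} -> R) :
    \sum_z h (cell z) = (\prod_(i < n) q i)%:R * \sum_y h y.
  rewrite (partition_big cell predT)//= mulr_sumr; apply: eq_bigr => y _.
  rewrite (eq_bigr (fun=> h y)); last by move=> z /eqP ->.
  by rewrite sumr_const -(card_cell y) mulr_natl cardsE.
have mn : (m ^ n)%N = ((\prod_(i < n) N i) * \prod_(i < n) q i)%N.
  rewrite -big_split/= (eq_bigr (fun=> m)) => [|i _]; last by rewrite -mq.
  by rewrite prod_nat_const card_ord.
have -> : (\sum_j G (T j)) / (\prod_(i < n) N i)%:R =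
    (\sum_(z : {ffun 'I_n -> 'I_m}) G (T (Yi (cell z)))) / (m ^ n)%:R.
  rewrite (sum_cell (fun y => G (T (Yi y)))).
  have -> : \sum_y G (T (Yi y)) = \sum_j G (T j).
    rewrite (reindex Y)/=; first by apply: eq_bigr => j _; rewrite YK.
    by exists Yi => ? _; rewrite ?YK ?YiK.
  rewrite mn natrM; field.
  have Q0 : (0 < \prod_(i < n) q i)%N by apply: prodn_gt0.
  by rewrite !pnatr_eq0 -!lt0n P0 Q0.
rewrite /midpoint_mean -mulrBl -sumrB normrM [`|_^-1|]ger0_norm ?invr_ge0//.
rewrite ler_pdivrMr ?ltr0n ?expn_gt0 ?m0//.
apply: (le_trans (ler_norm_sum _ _ _)).
have -> : eps * (m ^ n)%:R = \sum_(z : {ffun 'I_n -> 'I_m}) eps.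
  by rewrite sumr_const card_ffun !card_ord mulr_natr.
apply: ler_sum => z _.
have NR i : 0 < (N i)%:R :> R by rewrite ltr0n.
have DN i : 0 <= D i / (N i)%:R by rewrite divr_ge0.
have midE i : midpoint D z i = ((z i)%:R + 2^-1) / (q i)%:R * (D i / (N i)%:R).
  have -> : midpoint D z i = ((z i)%:R + 2^-1) * (D i / (N i * q i)%:R).
    by rewrite /midpoint -mq.
  rewrite natrM; field.
  by rewrite !pnatr_eq0 -!lt0n q0 N0.
have midP i : (cell z i)%:R * (D i / (N i)%:R) <= midpoint D z i <=
               (cell z i).+1%:R * (D i / (N i)%:R).
  rewrite midE ffunE /=; apply/andP; split; rewrite ler_wpM2r//.
    rewrite ler_pdivlMr ?ltr0n// -natrM (@le_trans _ _ (z i)%:R)//.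
      by rewrite ler_nat leq_divM.
    by rewrite lerDl invr_ge0.
  rewrite ler_pdivrMr ?ltr0n// -natrM (@le_trans _ _ (z i).+1%:R)//.
    rewrite -[leRHS]natr1; lra.
  by rewrite ler_nat ltn_ceil.
have TP i := TY (Yi (cell z)) i.
have box (s : 'I_n -> R) i : (cell z i)%:R * (D i / (N i)%:R) <= s i <=
    (cell z i).+1%:R * (D i / (N i)%:R) -> 0 <= s i <= D i.
  move=> /andP[s1 s2]; rewrite (le_trans _ s1) ?mulr_ge0//=.
  apply: (le_trans s2); rewrite mulrCA ler_piMr// ler_pdivrMr// mul1r ler_nat.
  exact: ltn_ord.
apply: Gde => i.
- by apply: box; have := TP i; rewrite YiK.
- exact: box.
- apply: le_trans (Ndelta i); have := TP i; rewrite YiK.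
  have := midP i; rewrite -natr1 mulrDl mul1r.
  move=> /andP[? ?] /andP[? ?]; rewrite ler_norml; apply/andP; split; lra.
Qed.

(** A midpoint grid is itself a tagged grid, and any two of them have a common
    refinement up to the order of the two factors. *)
Lemma midpoint_mean_close (R : realType) n (D : 'I_n -> R) G delta eps (m m' : nat) :
  (forall i, 0 <= D i) -> (0 < m)%N -> (0 < m')%N ->
  (forall i, D i / m%:R <= delta) -> box_close D G delta eps ->
  `|midpoint_mean D m G - midpoint_mean D (m' ^ n * m ^ n) G| <= eps.
Proof.
move=> D0 m0 m'0 Dm Gde.
have pE : (\prod_(i < n) m = m ^ n)%N by rewrite prod_nat_const card_ord.
have bij : bijective (id : {ffun 'I_n -> 'I_m} -> {dffun forall i : 'I_n, 'I_m}).
  by exists id.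
have mm : (m' ^ n * m ^ n = m' ^ n * \prod_(i < n) m)%N by rewrite pE.
have m'n : (0 < m' ^ n)%N by rewrite expn_gt0 m'0.
have := tagged_mean_midpoint D0 (fun=> m0) m'n mm bij (T := @midpoint R n D m)
   (fun z i => midpoint_tagged z (D0 i)) Dm Gde.
by rewrite pE.
Qed.

(** The limit exists and is the same for all choices of tags; it can therefore be
    computed on midpoint grids, which have exact symmetries. *)
Lemma riemann_sum_cvg (R : realType) n (D : 'I_n -> R) G :
  (forall i, 0 <= D i) -> uniformly_close D G ->
  exists2 l, midpoint_mean D m G @[m --> \oo] --> l &
  forall eps, 0 < eps -> exists K, forall (N : 'I_n -> nat) (J : finType)
    (Y : J -> {dffun forall i : 'I_n, 'I_(N i)}) (T : J -> 'I_n -> R),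
  (forall i, K <= N i)%N -> bijective Y ->
  (forall j i, (Y j i)%:R * (D i / (N i)%:R) <= T j i <=
               (Y j i).+1%:R * (D i / (N i)%:R)) ->
  `|(\sum_j G (T j)) / (\prod_(i < n) N i)%:R - l| <= eps.
Proof.
move=> D0 Gu.
have Kex delta : 0 < delta -> exists2 K, (0 < K)%N &
    forall m i, (K <= m)%N -> D i / m%:R <= delta.
  move=> d0; pose x := (\sum_i D i) / delta.
  have x0 : 0 <= x by rewrite divr_ge0 ?sumr_ge0// ltW.
  have xK := archi_boundP x0.
  exists (Num.bound x); first by rewrite -(ltr0n R) (le_lt_trans x0).
  move=> m i Km; have m0 : 0 < m%:R :> R.
    by rewrite (@lt_le_trans _ _ (Num.bound x)%:R) ?ler_nat// (le_lt_trans x0).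
  rewrite ler_pdivrMr// -ler_pdivrMl// mulrC.
  rewrite (@le_trans _ _ x)// ?(le_trans (ltW xK)) ?ler_nat//.
  by rewrite /x ler_wpM2r ?invr_ge0 ?(ltW d0)// (bigD1 i)//= lerDl sumr_ge0.
have cl eps : 0 < eps -> exists2 K, (0 < K)%N & forall m m', (K <= m)%N -> (K <= m')%N ->
    `|midpoint_mean D m G - midpoint_mean D m' G| <= eps.
  move=> e0; have [|d d0 Gd] := Gu (eps / 2); first by rewrite divr_gt0.
  have [K K0 HK] := Kex d d0; exists K => // m m' Km Km'.
  have m0 := leq_trans K0 Km; have m'0 := leq_trans K0 Km'.
  have h1 := midpoint_mean_close D0 m0 m'0 (fun i => HK m i Km) Gd.
  have := midpoint_mean_close D0 m'0 m0 (fun i => HK m' i Km') Gd.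
  rewrite mulnC distrC => h2.
  rewrite -(subrKA (midpoint_mean D (m' ^ n * m ^ n) G)).
  by rewrite (le_trans (ler_normD _ _))// [leRHS]splitr lerD.
have Gcvg : cvg (midpoint_mean D m G @[m --> \oo]).
  apply: cauchy_cvg; apply: cauchy_exP => eps e0.
  have [|K K0 HK] := cl (eps / 2); first by rewrite divr_gt0.
  exists (midpoint_mean D K G); exists K => // m /= Km.
  rewrite -ball_normE /=; apply: le_lt_trans (HK _ _ (leqnn K) Km) _.
  by rewrite ltr_pdivrMr// ltr_pMr// ltr1n.
exists (lim (midpoint_mean D m G @[m --> \oo])) => //.
move=> eps e0; have e3 : 0 < eps / 3 by rewrite divr_gt0.
have [d d0 Gd] := Gu _ e3.
have [K1 K10 HK1] := Kex d d0; have [K2 K20 HK2] := cl _ e3.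
have /cvgrPdist_le/(_ _ e3)[K3 _ HK3] := Gcvg.
exists K1 => N J Y T KN bY TY.
have N0 i : (0 < N i)%N by rewrite (leq_trans K10).
pose k := (maxn K2 K3).+1.
have P0 : (0 < \prod_(i < n) N i)%N by apply: prodn_gt0.
have := tagged_mean_midpoint D0 N0 (ltn0Sn _) (erefl (k * _)%N) bY TY
  (fun i => HK1 _ i (KN i)) Gd.
set a := _ / _; set M := (k * _)%N => h1.
have kM : (k <= M)%N by rewrite /M leq_pmulr.
have K3M : (K3 <= M)%N by rewrite (leq_trans _ kM)// /k leqW// leq_maxr.
have := HK3 M K3M; rewrite distrC => h2.
rewrite -(subrKA (midpoint_mean D M G)).
apply: (le_trans (ler_normD _ _)); apply: (le_trans (lerD h1 h2)); lra.
Qed.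

(** * Polar coordinates *)

(** The factor that the j-th parameter contributes to the i-th coordinate of a unit
    direction in dimension p + 2, the parameters being ordered as rho, theta,
    phi_1, ..., phi_p.  With one factor for each parameter, the mean of a power of a
    coordinate is a product of one-dimensional means. *)
Definition dir_factor (R : realType) (p i j : nat) (a : R) : R :=
  if j == 0%N then 1 else
  if j == 1%N then (if (i < p)%N then 1 else if i == p then cos a else sin a) else
  if (j < i.+2)%N then sin a else if j == i.+2 then cos a else 1.

Definition direction (R : realType) p (t : 'I_p.+2 -> R) (i : 'I_p.+2) : R :=
  \prod_(j < p.+2) dir_factor p i j (t j).

Definition polar_point (R : realType) p (t : 'I_p.+2 -> R) : 'cV[R]_p.+2 :=
  \col_i (t ord0 * direction t i).

Lemma prod_if_lt (R : comRingType) (p i : nat) (g h : nat -> R) :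
  \prod_(0 <= j < p) (if (j < i)%N then g j else if j == i then h j else 1) =
  if (i < p)%N then (\prod_(0 <= j < i) g j) * h i else \prod_(0 <= j < p) g j.
Proof.
case: ltnP => ip.
  rewrite (@big_cat_nat _ _ _ i)//=; last exact: ltnW.
  rewrite (@big_ltn _ _ _ i)// ltnn eqxx.
  rewrite [X in _ * (_ * X)]big1_seq => [|j]; last first.
    rewrite mem_index_iota => /andP[_ /andP[ij _]].
    by rewrite ltnNge (ltnW ij)/= gtn_eqF.
  rewrite mulr1; congr (_ * _).
  by apply: eq_big_seq => j; rewrite mem_index_iota => /andP[_ ->].
by apply: eq_big_seq => j; rewrite mem_index_iota => /andP[_ jp]; rewrite (leq_trans jp).
Qed.

Lemma directionE (R : realType) p (t : 'I_p.+2 -> R) (i : 'I_p.+2) (s : nat -> R) :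
  (forall j : 'I_p.+2, s j = t j) ->
  direction t i = if (i < p)%N then (\prod_(0 <= j < i) sin (s j.+2)) * cos (s i.+2)
    else (\prod_(0 <= j < p) sin (s j.+2)) * (if i == p :> nat then cos (s 1%N) else sin (s 1%N)).
Proof.
move=> st; rewrite /direction (eq_bigr (fun j : 'I_p.+2 => dir_factor p i j (s j))); last first.
  by move=> j _; rewrite st.
rewrite 2!big_ord_recl /= {1 2}/dir_factor /= mul1r.
rewrite -(big_mkord xpredT (fun j => dir_factor p i j.+2 (s j.+2))).
rewrite (eq_bigr (fun j => if (j < i)%N then sin (s j.+2) else if j == i then cos (s j.+2) else 1)).
  rewrite prod_if_lt; case: ifP => ip; first by rewrite mul1r.
  by rewrite mulrC.
by move=> j _; rewrite /dir_factor /= !ltnS !eqSS.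
Qed.

Lemma spherical_polar_point (R : realType) p (s : nat -> R) :
  spherical p.+2 (s 1%N) (s 2%N) (fun k => s (k + 2)%N) =
  polar_point (fun i : 'I_p.+2 => s i.+1).
Proof.
apply/colP => i; rewrite !mxE (@directionE _ _ _ _ (fun k => s k.+1))// !subn2 /=.
rewrite subn1 /= eqSS.
have E k : \prod_(1 <= l < k.+1) sin (s (l + 2)%N) = \prod_(0 <= j < k) sin (s j.+3) :> R.
  by rewrite big_add1 /=; apply: eq_bigr => j _; rewrite addn2.
by rewrite !E addn2 -mulrA; case: ifP => _ //; rewrite mulrA.
Qed.

(** If P_i is the product of the first i squared sines, then P_i cos^2 phi_(i+1) is
    P_i - P_(i+1), and the sum telescopes. *)
Lemma sum_sqr_direction (R : realType) p (t : 'I_p.+2 -> R) :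
  \sum_(i < p.+2) direction t i ^+ 2 = 1.
Proof.
pose s k : R := t (inord k).
have st (j : 'I_p.+2) : s j = t j by rewrite /s inord_val.
pose P k := \prod_(0 <= j < k) sin (s j.+2) ^+ 2.
rewrite (eq_bigr (fun i : 'I_p.+2 => if (i < p)%N then P i - P i.+1 else
   P p * (if i == p :> nat then cos (s 1%N) else sin (s 1%N)) ^+ 2)); last first.
  move=> i _; rewrite (directionE i st) /P; case: ifP => ip.
    rewrite exprMn -prodrXl big_nat_recr//=.
    rewrite -[X in _ = X - _]mulr1 -mulrBr; congr (_ * _).
    by rewrite cos2sin2.
  by rewrite exprMn -prodrXl.
rewrite -(big_mkord xpredT (fun i => if (i < p)%N then P i - P i.+1 else
   P p * (if i == p :> nat then cos (s 1%N) else sin (s 1%N)) ^+ 2)).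
rewrite big_nat_recr// big_nat_recr//= ltnn eqxx ltnNge leqnSn/= gtn_eqF// -addrA -mulrDr cos2Dsin2 mulr1.
rewrite (eq_big_nat _ _ (F2 := fun i => - (P i.+1 - P i))); last first.
  by move=> i /andP[_ ip]; rewrite ip opprB.
have P0 : P 0%N = 1 by rewrite /P big_geq.
by rewrite sumrN telescope_sumr// P0; ring.
Qed.

Lemma enorm_polar_point (R : realType) p (t : 'I_p.+2 -> R) :
  enorm (polar_point t) = `|t ord0|.
Proof.
rewrite /enorm (eq_bigr (fun i => t ord0 ^+ 2 * direction t i ^+ 2)).
  by rewrite -mulr_sumr sum_sqr_direction mulr1 sqrtr_sqr.
by move=> i _; rewrite mxE exprMn.
Qed.

Lemma sin_lipschitz (R : realType) (a b : R) : `|sin a - sin b| <= `|a - b|.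
Proof.
wlog ab : a b / b <= a.
  by move=> H; have [/H//|/ltW/H] := leP b a; rewrite distrC [leRHS]distrC.
rewrite [leRHS]ger0_norm ?subr_ge0//.
have := @le_increment R sin cos _ _ b a ab (fun t _ => is_derive_sin t)
  (fun t _ => is_derive_linear 1 t).
by rewrite !mulr1; apply => t _; exact: cos_max.
Qed.

Lemma cos_lipschitz (R : realType) (a b : R) : `|cos a - cos b| <= `|a - b|.
Proof.
have -> : a - b = (a + pi / 2) - (b + pi / 2) by ring.
by rewrite -!sinDpihalf sin_lipschitz.
Qed.

Lemma dir_factor_lipschitz (R : realType) p i j (a b : R) :
  `|dir_factor p i j a - dir_factor p i j b| <= `|a - b|.
Proof.
rewrite /dir_factor; repeat case: ifP => // _; rewrite ?subrr ?normr0//.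
all: by rewrite ?sin_lipschitz ?cos_lipschitz.
Qed.

Lemma dir_factor_le1 (R : realType) p i j (a : R) : `|dir_factor p i j a| <= 1.
Proof.
by rewrite /dir_factor; repeat case: ifP => // _; rewrite ?normr1 ?sin_max ?cos_max.
Qed.

Lemma prod_le1_dist (R : realType) (I : Type) (s : seq I) (F G : I -> R) :
  (forall i, `|F i| <= 1) -> (forall i, `|G i| <= 1) ->
  `|\prod_(i <- s) F i - \prod_(i <- s) G i| <= \sum_(i <- s) `|F i - G i|.
Proof.
move=> F1 G1; elim: s => [|i s IH]; first by rewrite !big_nil subrr normr0.
rewrite !big_cons.
have -> : F i * \prod_(j <- s) F j - G i * \prod_(j <- s) G j =
  (F i - G i) * \prod_(j <- s) F j + G i * (\prod_(j <- s) F j - \prod_(j <- s) G j).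
  by ring.
apply: (le_trans (ler_normD _ _)); rewrite !normrM lerD//.
  rewrite ler_piMr// normr_prod.
  suff /andP[_ ->] : 0 <= \prod_(j <- s) `|F j| <= 1 by [].
  apply: (big_ind (fun x => 0 <= x <= 1)); first by rewrite ler01 lexx.
  - by move=> x y /andP[? ?] /andP[? ?]; rewrite mulr_ge0// mulr_ile1.
  - by move=> j _; rewrite normr_ge0 F1.
by apply: le_trans IH; rewrite ler_piMl.
Qed.

Definition polar_range (R : realType) (r : R) p (i : 'I_p.+2) : R := grid_range r i.+1.

Lemma polar_range_ge0 (R : realType) (r : R) p (i : 'I_p.+2) : 0 <= r -> 0 <= polar_range r i.
Proof.
by move=> r0; rewrite /polar_range /grid_range; do 2 case: ifP => // _; rewrite ?mulr_ge0 ?pi_ge0.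
Qed.

(** Each coordinate is rho times a product of 1-Lipschitz factors bounded by 1. *)
Lemma polar_point_close (R : realType) (r delta : R) p (s t : 'I_p.+2 -> R) :
  (forall i, 0 <= s i <= polar_range r i) -> (forall i, 0 <= t i <= polar_range r i) ->
  (forall i, `|s i - t i| <= delta) ->
  enorm (polar_point s - polar_point t) <= p.+2%:R * (1 + r * p.+2%:R) * delta.
Proof.
move=> sD tD st; apply: (le_trans (enorm_le_sum _)).
have -> : p.+2%:R * (1 + r * p.+2%:R) * delta = \sum_(i < p.+2) (1 + r * p.+2%:R) * delta.
  by rewrite sumr_const card_ord -mulrA mulr_natl.
apply: ler_sum => i _; rewrite !mxE.
have -> : s ord0 * direction s i - t ord0 * direction t i =
  (s ord0 - t ord0) * direction s i + t ord0 * (direction s i - direction t i) by ring.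
apply: (le_trans (ler_normD _ _)); rewrite !normrM mulrDl mul1r; apply: lerD.
  apply: le_trans (st ord0); rewrite ler_piMr//.
  have := sum_sqr_direction s; rewrite (bigD1 i)//= => E.
  rewrite -(@expr_le1 _ 2)// real_normK ?num_real// -E lerDl.
  by apply: sumr_ge0 => j _; rewrite sqr_ge0.
have /andP[t0 tr] := tD ord0; rewrite ger0_norm// -mulrA ler_pM//.
rewrite /direction; apply: (le_trans (prod_le1_dist _ _ _)) => [j|j|];
  rewrite ?dir_factor_le1//.
rewrite mulr_natl -[X in _ *+ X](card_ord p.+2) -sumr_const; apply: ler_sum => j _.
by apply: le_trans (st j); exact: dir_factor_lipschitz.
Qed.

Lemma lipschitz_uniformly_close (R : realType) (r K : R) p (g : 'cV[R]_p.+2 -> R) :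
  0 <= r -> 0 <= K ->
  (forall x y, enorm x <= r -> enorm y <= r -> `|g x - g y| <= K * enorm (x - y)) ->
  uniformly_close (@polar_range R r p) (fun t => g (polar_point t)).
Proof.
move=> r0 K0 gK eps e0.
pose C : R := p.+2%:R * (1 + r * p.+2%:R).
have C0 : 0 <= C by rewrite mulr_ge0// addr_ge0// mulr_ge0.
have KC : 0 < K * C + 1 by rewrite ltr_wpDl// mulr_ge0.
exists (eps / (K * C + 1)); first by rewrite divr_gt0.
move=> s t sD tD st.
have inr (u : 'I_p.+2 -> R) : (forall i, 0 <= u i <= polar_range r i) ->
    enorm (polar_point u) <= r.
  by move=> uD; rewrite enorm_polar_point; have /andP[? ?] := uD ord0; rewrite ger0_norm.
apply: (le_trans (gK _ _ (inr _ sD) (inr _ tD))).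
apply: (le_trans (ler_wpM2l K0 (polar_point_close sD tD st))).
rewrite -/C; clearbody C; rewrite !mulrA ler_pdivrMr// [leLHS]mulrC ler_wpM2l ?(ltW e0)//.
by rewrite lerDl.
Qed.

Lemma gram_uniformly_close (R : realType) (r : R) p (i j : 'I_p.+2) : 0 <= r ->
  uniformly_close (@polar_range R r p) (fun t => polar_point t i 0 * polar_point t j 0).
Proof.
move=> r0.
apply: (@lipschitz_uniformly_close _ _ (r + r) _ (fun x : 'cV[R]_p.+2 => x i 0 * x j 0)) => //.
  by rewrite addr_ge0.
move=> x y xr yr.
have -> : x i 0 * x j 0 - y i 0 * y j 0 =
  x i 0 * (x - y) j 0 + y j 0 * (x - y) i 0 by rewrite !mxE; ring.
apply: (le_trans (ler_normD _ _)); rewrite !normrM mulrDl.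
by apply: lerD; rewrite ler_pM// ?(coord_le_enorm (x - y))// (le_trans (coord_le_enorm _ _)).
Qed.

Lemma moment_uniformly_close (R : realType) (r : R) p (x0 : 'cV[R]_p.+2)
    (f : 'cV[R]_p.+2 -> R) (U : set 'cV[R]_p.+2) (L : R) (i : 'I_p.+2) :
  0 <= r -> 0 <= L -> open U -> eball x0 r `<=` U -> class_C 2 U f ->
  lipschitz_hessian f (eball x0 r) L ->
  uniformly_close (@polar_range R r p)
    (fun t => polar_point t i 0 * (f (x0 + polar_point t) - f x0)).
Proof.
move=> r0 L0 oU bU fC fL.
have [K K0 fK] := lipschitz_on_ball oU bU fC fL L0 r0.
apply: (@lipschitz_uniformly_close _ _ (r * K + K * r) _
  (fun x : 'cV[R]_p.+2 => x i 0 * (f (x0 + x) - f x0))) => //.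
  by rewrite addr_ge0// mulr_ge0.
move=> x y xr yr.
have -> : x i 0 * (f (x0 + x) - f x0) - y i 0 * (f (x0 + y) - f x0) =
  x i 0 * (f (x0 + x) - f (x0 + y)) + (f (x0 + y) - f (x0 + 0)) * (x - y) i 0.
  by rewrite addr0 !mxE; ring.
have e0 : enorm (0 : 'cV[R]_p.+2) <= r.
  by rewrite /enorm big1 ?sqrtr0// => j _; rewrite mxE expr0n.
apply: (le_trans (ler_normD _ _)); rewrite !normrM mulrDl; apply: lerD.
  by rewrite -mulrA ler_pM// ?fK// (le_trans (coord_le_enorm _ _)).
rewrite ler_pM// ?(coord_le_enorm (x - y))// (le_trans (fK _ _ yr e0))// subr0.
by rewrite ler_wpM2l.
Qed.

(** * Moments of the polar grid *)

Definition interval_mean (R : realType) (m : nat) (d : R) (g : R -> R) : R :=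
  (\sum_(y < m) g ((y%:R + 2^-1) * (d / m%:R))) / m%:R.

Lemma midpoint_mean_prod (R : realType) n (D : 'I_n -> R) m (g : 'I_n -> R -> R) :
  midpoint_mean D m (fun t => \prod_(i < n) g i (t i)) = \prod_(i < n) interval_mean m (D i) (g i).
Proof.
rewrite /midpoint_mean /interval_mean prodf_div prodr_const card_ord natrX; congr (_ / _).
by rewrite bigA_distr_bigA.
Qed.

(** Multiplication by 2 sin (c / 2) turns the sum into a telescoping one. *)
Lemma sum_cos_midpoint (R : realType) (m : nat) (c : R) :
  sin (c / 2) != 0 -> sin (c * m%:R) = 0 -> \sum_(y < m) cos (c * (y%:R + 2^-1)) = 0.
Proof.
move=> s0 sm; apply/eqP; rewrite -(mulrI_eq0 _ (@mulfI _ (2 * sin (c / 2)) _)); last first.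
  by rewrite mulf_neq0.
rewrite mulr_sumr -(big_mkord xpredT (fun y => 2 * sin (c / 2) * cos (c * (y%:R + 2^-1)))).
rewrite (eq_bigr (fun y : nat => sin (c * y.+1%:R) - sin (c * y%:R))).
  by rewrite telescope_sumr// sm mulr0 sin0 subrr.
move=> y _; have -> : c * y.+1%:R = c * (y%:R + 2^-1) + c / 2.
  by rewrite -natr1; field.
have -> : c * y%:R = c * (y%:R + 2^-1) - c / 2 by field.
by rewrite sinD sinB; ring.
Qed.

(** Wallis' formula for the mean of cos^(2e) over a period. *)
Definition cos_moment (R : realType) (e : nat) : R := 'C(2 * e, e)%:R / 4 ^+ e.

Lemma cos_moment1 (R : realType) : cos_moment R 1 = 1 / 2.
Proof. by rewrite /cos_moment (_ : 'C(2 * 1, 1) = 2)//; field. Qed.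

Lemma cos_moment2 (R : realType) : cos_moment R 2 = 3 / 8.
Proof. by rewrite /cos_moment (_ : 'C(2 * 2, 2) = 6)//; field. Qed.

Lemma cos_moment3 (R : realType) : cos_moment R 3 = 5 / 16.
Proof. by rewrite /cos_moment (_ : 'C(2 * 3, 3) = 20)//; field. Qed.

(** The powers 2, 4 and 6 of cos and sin are combinations of 1 and of cos (2ja) with
    1 <= j <= 3, and the midpoint sums of the latter vanish exactly as soon as the
    grid has more than 6 points.  The angles phi_k range over [0, pi] (q = 1) and
    theta over [0, 2 pi] (q = 2). *)
Lemma interval_mean_trig (R : realType) (m q e : nat) (h : R -> R) :
  (0 < q <= 2)%N -> (6 < m)%N -> (0 < e <= 3)%N ->
  (h = cos \/ h = sin) ->
  interval_mean m (q%:R * pi) (fun a => h a ^+ (2 * e)) = cos_moment R e.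
Proof.
move=> /andP[q0 q2] m6 /andP[e0 e3] hE.
have m0 : (m%:R : R) != 0 by rewrite pnatr_eq0 -lt0n (leq_trans _ m6).
have mgt0 : 0 < (m%:R : R) by rewrite ltr0n (leq_trans _ m6).
pose al (y : nat) : R := (y%:R + 2^-1) * (q%:R * pi / m%:R).
have S j : (0 < j <= 3)%N -> \sum_(y < m) cos (2 * j%:R * al y) = 0.
  move=> /andP[j0 j3].
  have E y : 2 * j%:R * al y = (2 * j%:R * (q%:R * pi / m%:R)) * (y%:R + 2^-1).
    by rewrite /al; ring.
  rewrite (eq_bigr (fun y : 'I_m => cos (2 * j%:R * (q%:R * pi / m%:R) * (y%:R + 2^-1)))).
    apply: sum_cos_midpoint.
      have -> : 2 * j%:R * (q%:R * pi / m%:R) / 2 = (j * q)%:R / m%:R * pi :> R.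
        by rewrite natrM; field.
      rewrite gt_eqF// sin_gt0_pi//; apply/andP; split.
        by rewrite mulr_gt0 ?pi_gt0// divr_gt0// ltr0n muln_gt0 j0.
      rewrite gtr_pMl ?pi_gt0// ltr_pdivrMr// mul1r ltr_nat.
      by rewrite (leq_ltn_trans _ m6)// (leq_mul j3 q2).
    have -> : 2 * j%:R * (q%:R * pi / m%:R) * m%:R = 0 + pi *+ (j * q).*2 :> R.
      by rewrite -mul2n -(mulr_natr pi) !natrM; field.
    rewrite -[RHS](@sin0 R).
    elim: (j * q)%N => [|k IH]; first by rewrite mulr0n addr0.
    by rewrite doubleS -addn2 mulrnDr addrA sinD2pi.
  by move=> y _; rewrite E.
(* the only difference between cos and sin is the sign in the half-angle formula *)
pose sg : R := if asbool (h = cos) then 1 else -1.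
have sg2 : sg ^+ 2 = 1 by rewrite /sg; case: ifP; rewrite ?sqrrN expr1n.
have h2 a : h a ^+ 2 = (1 + sg * cos (2 * a)) / 2.
  have -> : cos (2 * a) = cos a ^+ 2 *+ 2 - 1 by rewrite mulr_natl cos_mulr2n.
  rewrite /sg; case: asboolP => [->|hc]; first by field.
  by case: hE => // ->; rewrite sin2cos2; field.
have C2 a : cos (2 * a) ^+ 2 = (1 + cos (4 * a)) / 2.
  have -> : 4 * a = (2 * a) *+ 2 by rewrite -mulr_natl; ring.
  by rewrite cos_mulr2n; field.
have C3 a : cos (2 * a) ^+ 3 = (cos (6 * a) + 3 * cos (2 * a)) / 4.
  have -> : 6 * a = (2 * a) *+ 2 + 2 * a by rewrite -mulr_natl; ring.
  rewrite cosD cos_mulr2n sin_mulr2n.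
  have := cos2Dsin2 (2 * a); set c := cos _; set s := sin _ => cs.
  have -> : (c ^+ 2 *+ 2 - 1) * c - (c * s) *+ 2 * s = 4 * c ^+ 3 - 3 * c.
    have s2 : s ^+ 2 = 1 - c ^+ 2 by rewrite -cs; ring.
    by ring: s2.
  by field.
have mean (w a1 a2 a3 : R) :
    (forall a, h a ^+ (2 * e) = w + a1 * cos (2 * a) + a2 * cos (4 * a) + a3 * cos (6 * a)) ->
    interval_mean m (q%:R * pi) (fun a => h a ^+ (2 * e)) = w.
  move=> H; rewrite /interval_mean (eq_bigr (fun y : 'I_m => w + a1 * cos (2 * 1%:R * al y)
      + a2 * cos (2 * 2%:R * al y) + a3 * cos (2 * 3%:R * al y))).
    rewrite !big_split/= -!mulr_sumr !S// !mulr0 !addr0 sumr_const card_ord.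
    by rewrite -[w *+ m]mulr_natr mulfK.
  by move=> y _; rewrite H -!natrM.
case: e e0 e3 mean => [|[|[|[|e]]]]//= _ _ mean.
- rewrite cos_moment1; by apply: (mean _ (sg / 2) 0 0) => a; rewrite h2; field.
- rewrite cos_moment2; apply: (mean _ (sg / 2) (1 / 8) 0) => a; rewrite (exprM _ 2 2) h2.
  have -> : ((1 + sg * cos (2 * a)) / 2) ^+ 2 =
    (1 + 2 * sg * cos (2 * a) + sg ^+ 2 * cos (2 * a) ^+ 2) / 4 by field.
  by rewrite sg2 C2; field.
- rewrite cos_moment3; apply: (mean _ (15 / 32 * sg) (3 / 16) (sg / 32)) => a; rewrite (exprM _ 2 3) h2.
  have -> : ((1 + sg * cos (2 * a)) / 2) ^+ 3 =
    (1 + 3 * sg * cos (2 * a) + 3 * sg ^+ 2 * cos (2 * a) ^+ 2 +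
     sg * sg ^+ 2 * cos (2 * a) ^+ 3) / 8 by field.
  by rewrite sg2 C2 C3; field.
Qed.

Lemma interval_mean_sqr (R : realType) (m : nat) (r : R) : (0 < m)%N ->
  interval_mean m r (fun a => a ^+ 2) = r ^+ 2 / 3 - r ^+ 2 / 12 * m%:R^-1 ^+ 2.
Proof.
move=> m0; have mN0 : (m%:R : R) != 0 by rewrite pnatr_eq0 -lt0n.
have H k : \sum_(y < k) (y%:R + 2^-1 : R) ^+ 2 = k%:R ^+ 3 / 3 - k%:R / 12.
  elim: k => [|k IH]; first by rewrite big_ord0; field.
  by rewrite big_ord_recr/= IH -natr1; field.
rewrite /interval_mean (eq_bigr (fun y : 'I_m => (r / m%:R) ^+ 2 * (y%:R + 2^-1) ^+ 2)).
  by rewrite -mulr_sumr H; field.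
by move=> y _; rewrite exprMn mulrC.
Qed.

Lemma interval_mean_pow4 (R : realType) (m : nat) (r : R) : (0 < m)%N ->
  interval_mean m r (fun a => a ^+ 4) <= r ^+ 4 / 5.
Proof.
move=> m0; have mN0 : (m%:R : R) != 0 by rewrite pnatr_eq0 -lt0n.
have mgt0 : 0 < (m%:R : R) by rewrite ltr0n.
have H k : \sum_(y < k) (y%:R + 2^-1 : R) ^+ 4 <= k%:R ^+ 5 / 5.
  elim: k => [|k IH]; first by rewrite big_ord0 expr0n mul0r.
  have E : k.+1%:R = k%:R + 1 :> R by rewrite natr1.
  rewrite big_ord_recr/= E; apply: (le_trans (lerD IH (lexx _))).
  have k0 : 0 <= (k%:R : R) by rewrite ler0n.
  rewrite -subr_ge0.
  have -> : (k%:R + 1) ^+ 5 / 5 - (k%:R ^+ 5 / 5 + (k%:R + 2^-1) ^+ 4) =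
    k%:R ^+ 2 / 2 + k%:R / 2 + 11 / 80 :> R by field.
  by rewrite !addr_ge0// ?mulr_ge0// ?exprn_ge0 ?invr_ge0.
rewrite /interval_mean (eq_bigr (fun y : 'I_m => (r / m%:R) ^+ 4 * (y%:R + 2^-1) ^+ 4)).
  rewrite -mulr_sumr ler_pdivrMr//.
  have -> : r ^+ 4 / 5 * m%:R = (r / m%:R) ^+ 4 * (m%:R ^+ 5 / 5) by field.
  by apply: ler_wpM2l; [exact: exprn_even_ge0|exact: H].
by move=> y _; rewrite exprMn mulrC.
Qed.

(** The i-th coordinate of the direction depends on minn i.+1 p.+1 angles, and each
    of them contributes the same factor to the mean. *)
Lemma mean_direction (R : realType) (r : R) p m a e (i : 'I_p.+2) :
  (6 < m)%N -> (0 < e <= 3)%N ->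
  midpoint_mean (@polar_range R r p) m (fun t => t ord0 ^+ a * direction t i ^+ (2 * e)) =
  interval_mean m r (fun x => x ^+ a) * cos_moment R e ^+ minn i.+1 p.+1.
Proof.
move=> m6 e3; have m0 : (0 < m)%N by rewrite (leq_trans _ m6).
have mN0 : (m%:R : R) != 0 by rewrite pnatr_eq0 -lt0n.
pose g (j : 'I_p.+2) (x : R) := if j == ord0 then x ^+ a else dir_factor p i j x ^+ (2 * e).
have -> : (fun t : 'I_p.+2 -> R => t ord0 ^+ a * direction t i ^+ (2 * e)) =
    (fun t => \prod_j g j (t j)).
  apply/funext => t; rewrite /direction -prodrXl !big_ord_recl /= /g /=.
  by rewrite {1}/dir_factor /= expr1n mul1r.
have m1 d : interval_mean m d (fun=> 1 ^+ (2 * e)) = 1 :> R.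
  by rewrite /interval_mean expr1n sumr_const card_ord divff.
rewrite midpoint_mean_prod 2!big_ord_recl; congr (_ * _).
set w := cos_moment R e.
have -> : interval_mean m (polar_range r (lift ord0 ord0)) (g (lift ord0 ord0)) =
    if (i < p)%N then 1 else w.
  rewrite /polar_range /grid_range /g /dir_factor /=; case: (ltnP i p) => _.
    by move=> *; exact: m1.
  by move=> _; case: eqP => _; apply: interval_mean_trig => //; [left|right].
rewrite (eq_bigr (fun j : 'I_p => if (j < i.+1)%N then w else if j == i.+1 :> nat then 1 else 1)).
  rewrite -(big_mkord xpredT (fun j => if (j < i.+1)%N then w else if j == i.+1 then 1 else 1)).
  rewrite (@prod_if_lt _ p i.+1 (fun=> w) (fun=> 1)).
  rewrite !prodr_const_nat !subn0 mulr1 /minn ltnS.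
  have [ip|ip] := ltnP i p.
    rewrite mul1r; case: ltnP => // pi; congr (_ ^+ _).
    by apply/eqP; rewrite eqn_leq pi ip.
  by rewrite ltnNge (leq_trans ip)//= exprS.
move=> j _.
rewrite /polar_range /grid_range /g /dir_factor /= -[X in interval_mean _ X](mul1r pi) -[X in interval_mean _ (X * _)]/(1%:R).
rewrite !ltnS !eqSS.
have [ji|ji|ji] := ltngtP j i; [|by case: eqP => _; exact: m1|].
- by apply: (@interval_mean_trig R m 1) => //; right.
- by apply: (@interval_mean_trig R m 1) => //; left.
Qed.

(** * Sign symmetries of the polar grid *)

Definition flip (R : realType) n (i : 'I_n) (x : 'cV[R]_n) : 'cV[R]_n :=
  \col_k (if k == i then - x k 0 else x k 0).

(** The reflection a -> pi - a permutes the midpoint grid of the circle when the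
    number of points is even. *)
Lemma half_turn_reflection (R : realType) (m : nat) : ~~ odd m -> (0 < m)%N ->
  exists2 h : 'I_m -> 'I_m, bijective h & forall y : 'I_m,
    let a (y : 'I_m) : R := (y%:R + 2^-1) * (2 * pi / m%:R) in
    cos (a (h y)) = - cos (a y) /\ sin (a (h y)) = sin (a y).
Proof.
move=> me m0; pose q := m./2.
have mE : m = (q + q)%N by rewrite addnn even_halfK.
have q0 : (0 < q)%N by rewrite -double_gt0 -addnn -mE.
(* the index of pi - a y, reduced modulo m *)
pose h' y := (if y < q then q.-1 - y else (q + m).-1 - y)%N.
have hlt (y : 'I_m) : (h' y < m)%N.
  by rewrite /h'; have := ltn_ord y; case: (ltnP y q); lia.
pose h (y : 'I_m) := Ordinal (hlt y).
have hK : cancel h h.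
  move=> y; apply: val_inj; rewrite /= /h'; have ym := ltn_ord y.
  by case: (ltnP y q) => yq; case: ltnP; lia.
exists h; first by exists h.
have mN0 : (q%:R : R) != 0 by rewrite pnatr_eq0 -lt0n.
have mR : m%:R = 2 * q%:R :> R by rewrite [in LHS]mE natrD; ring.
move=> y a.
have aE (k : 'I_m) : a k = (k%:R + 2^-1) * (pi / q%:R).
  by rewrite /a mR; field.
have [yq|qy] := ltnP y q.
  have -> : a (h y) = pi - a y.
    rewrite !aE /= /h' yq natrB; last by lia.
    by rewrite -subn1 natrB//; field.
  by rewrite cosB sinB cospi sinpi; split; ring.
have -> : a (h y) = pi - a y + pi *+ 2.
  rewrite !aE /= /h' ltnNge qy/= natrB; last by have := ltn_ord y; lia.
  rewrite -subn1 natrB; last by lia.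
  by rewrite natrD mR -(mulr_natr pi); field.
by rewrite sinD2pi cosD2pi cosB sinB cospi sinpi; split; ring.
Qed.

Lemma midpoint_rev (R : realType) (m : nat) (y : 'I_m) :
  (rev_ord y)%:R + 2^-1 = m%:R - (y%:R + 2^-1) :> R.
Proof. by rewrite /= natrB// -natr1; field. Qed.

(** Each coordinate can be negated alone by reflecting a single angle:
    phi_k -> pi - phi_k negates cos phi_k and fixes sin phi_k, theta -> pi - theta
    does the same with cos theta, and theta -> 2 pi - theta negates sin theta. *)
Lemma angle_reflection (R : realType) (r : R) p m (i : 'I_p.+2) :
  ~~ odd m -> (0 < m)%N ->
  exists j0 : 'I_p.+2, exists2 h : 'I_m -> 'I_m, j0 != ord0 /\ bijective h &
    forall (k : 'I_p.+2) y,
    dir_factor p k j0 (((h y)%:R + 2^-1) * (polar_range r j0 / m%:R)) =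
    (if k == i then -1 else 1) * dir_factor p k j0 ((y%:R + 2^-1) * (polar_range r j0 / m%:R)).
Proof.
move=> me m0; have mN0 : (m%:R : R) != 0 by rewrite pnatr_eq0 -lt0n.
have revE (y : 'I_m) (d : R) : ((rev_ord y)%:R + 2^-1) * (d / m%:R) =
    d - (y%:R + 2^-1) * (d / m%:R).
  by rewrite midpoint_rev//; field.
have bijr : bijective (@rev_ord m) by exists (@rev_ord m) => ?; rewrite rev_ordK.
have [ip|ip] := ltnP i p.
  have lt2 : (i.+2 < p.+2)%N by [].
  exists (Ordinal lt2), (@rev_ord m) => // k y.
  rewrite revE /polar_range /grid_range /dir_factor /=.
  rewrite !ltnS !eqSS -val_eqE /=.
  case: ltngtP => ki; rewrite ?mul1r//.
    by rewrite sinB cospi sinpi; ring.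
  by rewrite cosB cospi sinpi; ring.
have lt1 : (1 < p.+2)%N by [].
have [ie|ine] := eqVneq (i : nat) p.
  have [h bh hE] := half_turn_reflection R me m0.
  exists (Ordinal lt1), h => // k y; have [/= hc hs] := hE y.
  rewrite /polar_range /grid_range /dir_factor /= hc hs -val_eqE /= ie.
  by case: ltngtP => kp; rewrite ?mul1r ?mulN1r.
have ip1 : i = p.+1 :> nat.
  by apply/eqP; rewrite eqn_leq -ltnS ltn_ord/= ltn_neqAle eq_sym ine.
exists (Ordinal lt1), (@rev_ord m) => // k y.
rewrite revE /polar_range /grid_range /dir_factor /= -val_eqE /= ip1.
rewrite mulr_natl sinB cosB cos2pi sin2pi.
have [kp|kp|kp] := ltngtP k p.
- by rewrite ltn_eqF ?mul1r// ltnW.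
- have -> : k = p.+1 :> nat by apply/eqP; rewrite eqn_leq kp -ltnS ltn_ord.
  by rewrite eqxx; ring.
- by rewrite kp ltn_eqF//; ring.
Qed.

Lemma midpoint_mean_flip (R : realType) (r : R) p m (i : 'I_p.+2) (g : 'cV[R]_p.+2 -> R) :
  ~~ odd m -> (0 < m)%N ->
  midpoint_mean (@polar_range R r p) m (fun t => g (polar_point t)) =
  midpoint_mean (@polar_range R r p) m (fun t => g (flip i (polar_point t))).
Proof.
move=> me m0; have [j0 [h [j00 [h' hK h'K]] hE]] := angle_reflection r i me m0.
pose tau (f : 'I_m -> 'I_m) (z : {ffun 'I_p.+2 -> 'I_m}) : {ffun 'I_p.+2 -> 'I_m} :=
  [ffun j => if j == j0 then f (z j) else z j].
rewrite /midpoint_mean (reindex (tau h)) /=; last first.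
  by exists (tau h') => z _; apply/ffunP => j; rewrite !ffunE; case: eqP.
congr (_ / _); apply: eq_bigr => z _; congr g.
apply/colP => k; rewrite !mxE.
have -> : midpoint (@polar_range R r p) (tau h z) ord0 = midpoint (@polar_range R r p) z ord0.
  by rewrite /midpoint ffunE eq_sym (negbTE j00).
have -> : direction (midpoint (@polar_range R r p) (tau h z)) k =
   (if k == i then -1 else 1) * direction (midpoint (@polar_range R r p) z) k.
  rewrite /direction (bigD1 j0)//= [in RHS](bigD1 j0)//= mulrA; congr (_ * _).
    by rewrite /midpoint ffunE eqxx hE.
  by apply: eq_bigr => j jj0; rewrite /midpoint ffunE (negbTE jj0).
by case: eqP => _; ring.
Qed.

Lemma midpoint_mean_flips (R : realType) (r : R) p m (s : seq 'I_p.+2) (g : 'cV[R]_p.+2 -> R) :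
  ~~ odd m -> (0 < m)%N ->
  midpoint_mean (@polar_range R r p) m (fun t => g (polar_point t)) =
  midpoint_mean (@polar_range R r p) m (fun t => g (foldr (@flip R p.+2) (polar_point t) s)).
Proof.
move=> me m0; elim: s g => [//|i s IH] g /=.
by rewrite (midpoint_mean_flip r i g me m0) (IH (fun x => g (flip i x))).
Qed.

Lemma foldr_flip_enum (R : realType) n (x : 'cV[R]_n) :
  foldr (@flip R n) x (enum 'I_n) = - x.
Proof.
have H (s : seq 'I_n) k : (foldr (@flip R n) x s) k 0 = (-1) ^+ count_mem k s * x k 0.
  elim: s => [|i s IH] /=; first by rewrite mul1r.
  by rewrite mxE IH eq_sym; case: eqP => _; rewrite ?add0n// add1n exprS; ring.
apply/colP => k; rewrite H count_uniq_mem ?enum_uniq// mem_enum inE expr1 mulN1r.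
by rewrite mxE.
Qed.

(** The mean of 3c^2 - (7/2)c^4 + (3/2)c^6 for a coordinate c of the direction that
    depends on k angles. *)
Definition moment_weight (R : realType) (k : nat) : R :=
  3 * cos_moment R 1 ^+ k - 7 / 2 * cos_moment R 2 ^+ k + 3 / 2 * cos_moment R 3 ^+ k.

(** The mean is unchanged by composition with the flip of x_i, the antipodal map, or
    both; averaging the four expressions isolates the odd part. *)
Lemma mean_odd_part (R : realType) (r : R) p m (x0 : 'cV[R]_p.+2) (f : 'cV[R]_p.+2 -> R)
    (i : 'I_p.+2) : ~~ odd m -> (0 < m)%N ->
  midpoint_mean (@polar_range R r p) m
    (fun t => polar_point t i 0 * (f (x0 + polar_point t) - f x0)) =
  midpoint_mean (@polar_range R r p) m (fun t => let x := polar_point t in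
    let u := x i 0 *: basis_vec R i in x i 0 * odd_part x0 f u (x - u)).
Proof.
move=> me m0; pose F (x : 'cV[R]_p.+2) := x i 0 * (f (x0 + x) - f x0).
set M := midpoint_mean _ m.
have M1 : M (F \o @polar_point R p) = M (fun t => F (flip i (polar_point t))).
  exact: midpoint_mean_flip.
have M2 : M (F \o @polar_point R p) = M (fun t => F (- polar_point t)).
  rewrite [LHS](midpoint_mean_flips r (enum 'I_p.+2) F me m0); congr M.
  by apply/funext => t; rewrite foldr_flip_enum.
have M3 : M (F \o @polar_point R p) = M (fun t => F (flip i (- polar_point t))).
  rewrite [LHS](midpoint_mean_flips r (i :: enum 'I_p.+2) F me m0); congr M.
  by apply/funext => t /=; rewrite foldr_flip_enum.
transitivity (4^-1 * (M (F \o @polar_point R p) + M (fun t => F (flip i (polar_point t))) +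
  M (fun t => F (- polar_point t)) + M (fun t => F (flip i (- polar_point t))))).
  by rewrite -M1 -M2 -M3 -[LHS]/(M (F \o @polar_point R p)); field.
rewrite -!midpoint_meanD -midpoint_meanZ; congr M.
apply/funext => t /=; set x := polar_point t; set u := _ *: _.
have E1 : x = u + (x - u) by rewrite addrC subrK.
have ui k : u k 0 = if k == i then x i 0 else 0.
  by rewrite !mxE eqxx andbT; case: eqP => _; rewrite ?mulr1 ?mulr0.
clearbody u x.
have E2 : flip i x = - u + (x - u).
  by apply/colP => k; rewrite !mxE ui; case: eqP => [->|_]; ring.
have E3 : - x = - u - (x - u) by rewrite opprB addKr.
have E4 : flip i (- x) = u - (x - u).
  by apply/colP => k; rewrite !mxE ui; case: eqP => [->|_]; ring.
rewrite /F E4 E3 E2 /odd_part -E1.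
have -> : (- u + (x - u)) i 0 = - x i 0 by rewrite -E2 !mxE eqxx.
have -> : (- u - (x - u)) i 0 = - x i 0 by rewrite -E3 !mxE.
have -> : (u - (x - u)) i 0 = x i 0 by rewrite -E4 !mxE eqxx opprK.
by field.
Qed.

(** The pointwise bound of [odd_part_bound] has a mean that [mean_direction]
    computes. *)
Lemma mean_remainder (R : realType) (r : R) p m (x0 : 'cV[R]_p.+2)
    (f : 'cV[R]_p.+2 -> R) (U : set 'cV[R]_p.+2) (L : R) (i : 'I_p.+2) :
  ~~ odd m -> (6 < m)%N -> 0 <= r -> 0 <= L ->
  open U -> eball x0 r `<=` U -> class_C 2 U f ->
  lipschitz_hessian f (eball x0 r) L ->
  `|midpoint_mean (@polar_range R r p) m
      (fun t => polar_point t i 0 * (f (x0 + polar_point t) - f x0)) -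
    midpoint_mean (@polar_range R r p) m (fun t => polar_point t i 0 * polar_point t i 0) *
      partial i f x0| <=
  L / 6 * interval_mean m r (fun a => a ^+ 4) * moment_weight R (minn i.+1 p.+1).
Proof.
move=> me m6 r0 L0 oU bU fC fL; have m0 : (0 < m)%N by rewrite (leq_trans _ m6).
rewrite mean_odd_part// mulrC -mulNr -midpoint_meanZ -midpoint_meanD.
pose H (t : 'I_p.+2 -> R) := L / 6 * (3 * (t ord0 ^+ 4 * direction t i ^+ (2 * 1)) +
    - (7 / 2) * (t ord0 ^+ 4 * direction t i ^+ (2 * 2)) +
    3 / 2 * (t ord0 ^+ 4 * direction t i ^+ (2 * 3))).
have -> : L / 6 * interval_mean m r (fun a => a ^+ 4) * moment_weight R (minn i.+1 p.+1) =
    midpoint_mean (@polar_range R r p) m H.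
  rewrite /H midpoint_meanZ !midpoint_meanD !midpoint_meanZ !mean_direction//.
  rewrite /moment_weight; ring.
apply: midpoint_mean_le => z /=; set t := midpoint _ z.
set x := polar_point t; set u := _ *: _.
have /andP[rho0 rhor] : 0 <= t ord0 <= r.
  exact: (@midpoint_in_box _ _ (@polar_range R r p) m z ord0).
have xi : x i 0 = t ord0 * direction t i by rewrite mxE.
have Eu : enorm u = t ord0 * `|direction t i|.
  rewrite enormZ xi normrM ger0_norm//.
  have -> : enorm (basis_vec R i) = 1; last by rewrite mulr1.
  rewrite /enorm (bigD1 i)//= !mxE !eqxx expr1n big1 ?addr0 ?sqrtr1// => j.
  by rewrite !mxE => /negbTE ->; rewrite expr0n.
have Euw : enorm (u + (x - u)) = t ord0.
  by rewrite addrC subrK enorm_polar_point ger0_norm.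
have ui k : u k 0 = if k == i then x i 0 else 0.
  by rewrite !mxE eqxx andbT; case: eqP => _; rewrite ?mulr1 ?mulr0.
clearbody u x.
have uw : \sum_k u k 0 * (x - u) k 0 = 0.
  apply: big1 => k _; rewrite !mxE ui.
  by case: eqP => [->|_]; rewrite ?subrr ?mulr0 ?mul0r.
have rr : 0 <= t ord0 <= r by rewrite rho0.
have := odd_part_bound oU bU fC fL L0 uw (normr_ge0 _) rr Eu Euw.
have dirE : dirder f u x0 = x i 0 * partial i f x0.
  rewrite /dirder (bigD1 i)//= ui eqxx big1 ?addr0// => k /negbTE ki.
  by rewrite ui ki mul0r.
have -> : x i 0 * odd_part x0 f u (x - u) + - partial i f x0 * (x i 0 * x i 0) =
  x i 0 * (odd_part x0 f u (x - u) - dirder f u x0) by rewrite dirE; ring.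
have xn : `|x i 0| = enorm u by rewrite Eu xi normrM ger0_norm.
rewrite normrM xn => /le_trans; apply.
have even k : `|direction t i| ^+ (2 * k) = direction t i ^+ (2 * k).
  by rewrite !exprM real_normK ?num_real.
have := even 1%N; have := even 2%N; have := even 3%N; rewrite !mulnE /= => e3 e2 e1.
rewrite e1 e2 e3 /H le_eqVlt; apply/orP; left; apply/eqP.
by rewrite !mulnE /=; field.
Qed.

(** * The Gamma function at half-integers *)

(** From 1 + x <= exp x at x = t / (2p), raised to the power p. *)
Lemma powR_mul_expR_le (R : realType) (p : R) : 0 < p ->
  exists2 C, 0 < C & forall t, 0 <= t -> t `^ p * expR (- t) <= C * expR (- (t / 2)).
Proof.
move=> p0; have p2 : 0 < 2 * p by rewrite mulr_gt0.
exists ((2 * p) `^ p); first exact: powR_gt0.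
move=> t t0.
have -> : expR (- t) = expR (- (t / 2)) * expR (- (t / 2)).
  by rewrite -expRD; congr expR; field.
rewrite mulrA ler_wpM2r ?expR_ge0// expRN ler_pdivrMr ?expR_gt0//.
have {1}-> : t = 2 * p * (t / (2 * p)) by field; rewrite gt_eqF.
rewrite powRM ?divr_ge0 ?(ltW p2)// ler_wpM2l ?powR_ge0//.
have -> : expR (t / 2) = expR (t / (2 * p)) `^ p.
  by rewrite /powR gt_eqF ?expR_gt0// expRK; congr expR; field; rewrite gt_eqF.
rewrite ge0_ler_powR ?nnegrE ?expR_ge0 ?divr_ge0 ?(ltW p0) ?(ltW p2)//.
by apply: le_trans (expR_ge1Dx _); rewrite lerDr.
Qed.

Section gamma.
Context (R : realType).
Notation mu := (@lebesgue_measure R).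
Local Notation h p := (fun t : R => t `^ p * expR (- t)).
Local Notation E := (fun t : R => expR (- (t / 2))).

Lemma is_derive_half_exp (t : R) : is_derive t 1 E (- (E t / 2)).
Proof.
have -> : E = expR \o (fun t : R => t * (- 2^-1)).
  by apply/funext => s /=; rewrite mulrN.
have := is_derive_linear (- 2^-1) t => H.
have := is_derive1_comp (is_derive_expR _) H; move/is_derive_eq; apply.
by rewrite /= !mulrN.
Qed.

Lemma cvg_half_exp : E t @[t --> +oo] --> (0 : R).
Proof.
have -> : E = (fun s => expR (- s)) \o (fun t => 2^-1 * t).
  by apply/funext => s /=; rewrite mulrC.
apply: (@cvg_comp _ _ _ _ _ _ (pinfty_nbhs R)); last exact: cvgr_expR.
exact: gt0_cvgMry.
Qed.

Lemma measurable_gamma_integrand p (D : set R) :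
  measurable D -> measurable_fun D (h p : R -> R).
Proof.
move=> mD; apply/measurable_funTS.
apply: measurable_funM; first exact: measurable_powR.
by apply: measurableT_comp => //; exact: oppr_measurable.
Qed.

Lemma continuous_half_exp : continuous E.
Proof.
move=> t; apply/differentiable_continuous/derivable1_diffP.
by have [] := is_derive_half_exp t.
Qed.

(** exp (- t / 2) is the common integrable majorant of all the integrands of Gamma. *)
Lemma integral_half_exp (C : R) : 0 <= C ->
  (\int[mu]_(t in `[0%R, +oo[) (C * E t)%:E = (2 * C)%:E)%E.
Proof.
move=> C0.
have cE (k : R) : continuous (fun t => k * E t).
  by move=> t; apply: cvgM; [exact: cvg_cst|exact: continuous_half_exp].
rewrite (@ge0_continuous_FTC2y _ (fun t => C * E t) (fun t => (- (2 * C)) * E t) 0 0).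
- by rewrite mul0r oppr0 expR0 mulr1 EFinN oppeK add0e.
- by move=> x _; rewrite mulr_ge0 ?expR_ge0.
- exact: continuous_subspaceT.
- by rewrite -(mulr0 (- (2 * C))); apply: cvgM; [exact: cvg_cst|exact: cvg_half_exp].
- by move=> x _; have [] := is_deriveZ (- (2 * C)) (is_derive_half_exp x).
- exact/cvg_at_right_filter/cE.
- move=> x _; rewrite derive1E.
  have [_ ->] := is_deriveZ (- (2 * C)) (is_derive_half_exp x).
  by rewrite /GRing.scale/=; field.
Qed.

Lemma integrable_half_exp (C : R) : 0 <= C ->
  mu.-integrable `]0%R, +oo[ (EFin \o (fun t => C * E t)).
Proof.
move=> C0.
have mE : measurable_fun setT (EFin \o (fun t => C * E t)).
  apply/measurable_EFinP; apply: continuous_measurable_fun => t.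
  by apply: cvgM; [exact: cvg_cst|exact: continuous_half_exp].
apply: (@integrableS _ _ _ mu `[0%R, +oo[) => //.
  by move=> x; rewrite /= !in_itv/= !andbT => /ltW.
apply/integrableP; split; first exact: measurable_funTS.
under eq_integral do rewrite /= ger0_norm ?mulr_ge0 ?expR_ge0//.
by rewrite integral_half_exp// ltry.
Qed.

Lemma integrable_gamma (p : R) : 0 < p -> mu.-integrable `]0%R, +oo[ (EFin \o h p).
Proof.
move=> p0; have [C C0 HC] := powR_mul_expR_le p0.
apply: (le_integrable _ _ _ (integrable_half_exp (ltW C0))) => //.
  by apply/measurable_EFinP; exact: measurable_gamma_integrand.
move=> t /=; rewrite in_itv/= andbT => t0; rewrite lee_fin.
rewrite ger0_norm ?mulr_ge0 ?powR_ge0 ?expR_ge0// (le_trans (HC t (ltW t0)))//.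
exact: ler_norm.
Qed.

Lemma integrable_gammaZ (k p : R) : 0 < p ->
  mu.-integrable `]0%R, +oo[ (EFin \o (fun t => k * h p t)).
Proof.
move=> p0.
have -> : EFin \o (fun t => k * h p t) = (fun t => k%:E * (h p t)%:E)%E.
  by apply/funext => t; rewrite /= EFinM.
by apply: integrableZl => //; exact: integrable_gamma.
Qed.

(** The derivative of t^(p+1) exp (- t) changes sign, while the fundamental theorem
    of calculus on a half-line is for functions of constant sign; adding
    C exp (- t / 2) makes the derivative nonnegative, and the integral of the added
    term is subtracted at the end. *)
Lemma Gamma_rec (p : R) : 0 < p ->
  \int[mu]_(t in `]0, +oo[) (h (p + 1) t) = (p + 1) * \int[mu]_(t in `]0, +oo[) (h p t).
Proof.
move=> p0; have p10 : 0 < p + 1 by rewrite addr_gt0.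
have [C C0 HC] := powR_mul_expR_le p10.
pose f (t : R) : R := ((p + 1) * h p t - h (p + 1) t) + C * E t.
pose F (t : R) : R := h (p + 1) t + (- (2 * C)) * E t.
have ch (q : R) : 0 < q -> h q t @[t --> 0^'+] --> h q 0.
  move=> q0; apply: cvgM; first by rewrite powR0 ?gt_eqF//; exact: powR_cvg0.
  apply: cvg_at_right_filter; apply: continuous_comp; first exact: opp_continuous.
  exact: continuous_expR.
have dh (q t : R) : 0 < t -> is_derive t 1 (h q) (q * h (q - 1) t - h q t).
  move=> t0; have H1 := is_derive1_powR q t0.
  have H2 : is_derive t 1 (fun t : R => expR (- t)) (- expR (- t)).
    have H : is_derive t 1 (@GRing.opp R) (-1) by exact: is_deriveNid.
    have := is_derive1_comp (is_derive_expR _) H; move/is_derive_eq; apply.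
    by rewrite mulrN1.
  apply: is_derive_eq.
  by rewrite /GRing.scale/=; ring.
have cE (k : R) : continuous (fun t => k * E t).
  by move=> t; apply: cvgM; [exact: cvg_cst|exact: continuous_half_exp].
have FTC : (\int[mu]_(t in `[0%R, +oo[) (f t)%:E = (2 * C)%:E)%E.
  rewrite (@ge0_continuous_FTC2y _ f F 0 0).
  - have -> : F 0 = - (2 * C) by rewrite /F powR0 ?gt_eqF// !mul0r oppr0 expR0 mulr1 add0r.
    by rewrite EFinN oppeK add0e.
  - move=> t t0; rewrite /f -addrA addrC; have := HC t t0; have : 0 <= (p + 1) * h p t.
      by rewrite mulr_ge0 ?(ltW p10)// mulr_ge0 ?powR_ge0 ?expR_ge0.
    by cbv beta; lra.
  - apply/continuous_within_itvcyP; split.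
      move=> t; rewrite in_itv/= andbT => t0.
      have cc (q : R) : {for t, continuous (h q)}.
        apply/differentiable_continuous/derivable1_diffP.
        by have [] := dh q t t0.
      apply: cvgD; last exact: cE.
      by apply: cvgB; [apply: cvgM; [exact: cvg_cst|exact: cc]|exact: cc].
    apply: cvgD; last exact/cvg_at_right_filter/cE.
    by apply: cvgB; [apply: cvgM; [exact: cvg_cst|exact: ch]|exact: ch].
  - rewrite -(addr0 0); apply: cvgD; last first.
      by rewrite -(mulr0 (- (2 * C))); apply: cvgM; [exact: cvg_cst|exact: cvg_half_exp].
    apply: (@squeeze_cvgr _ _ _ _ (fun=> 0) (fun t => C * E t)).
    + near=> t; have t0 : 0 <= t by near: t; exact: nbhs_pinfty_ge.
      by rewrite HC// mulr_ge0 ?powR_ge0 ?expR_ge0.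
    + exact: cvg_cst.
    + by rewrite -(mulr0 C); apply: cvgM; [exact: cvg_cst|exact: cvg_half_exp].
  - move=> t t0; apply: derivableD; first by have [] := dh (p + 1) t t0.
    by have [] := is_deriveZ (- (2 * C)) (is_derive_half_exp t).
  - by apply: cvgD; [exact: ch|exact/cvg_at_right_filter/cE].
  - move=> t; rewrite in_itv/= andbT => t0; rewrite derive1E.
    have [_ ->] := is_deriveD (dh (p + 1) t t0) (is_deriveZ (- (2 * C)) (is_derive_half_exp t)).
    by rewrite /GRing.scale/= addrK /f; field.
have ih1 := integrable_gamma p0; have ih2 := integrable_gamma p10.
have iE := integrable_half_exp (ltW C0).
have ih1' := integrable_gammaZ (p + 1) p0.
have ih : mu.-integrable `]0%R, +oo[ (EFin \o (fun t => (p + 1) * h p t - h (p + 1) t)).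
  exact: (integrableB _ ih1' ih2).
have if_ : mu.-integrable `]0%R, +oo[ (EFin \o f).
  exact: (integrableD _ ih iE).
have I1 : \int[mu]_(t in `]0, +oo[) f t = 2 * C.
  by rewrite Rintegral_itv_obnd_cbnd// /Rintegral FTC.
have I2 : \int[mu]_(t in `]0, +oo[) (C * E t) = 2 * C.
  by rewrite Rintegral_itv_obnd_cbnd// /Rintegral integral_half_exp// ltW.
move: I1; rewrite /f RintegralD// I2 RintegralB// RintegralZl//.
by cbv beta; lra.
Unshelve. all: by end_near. Qed.

Lemma integral_gamma_gt0 (p : R) : 0 < p -> 0 < \int[mu]_(t in `]0, +oo[) (h p t).
Proof.
move=> p0; have ih := integrable_gamma p0.
have sub : `[1%R, 2%R]%classic `<=` (`]0%R, +oo[ : set R).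
  by move=> t; rewrite /= !in_itv/= andbT => /andP[t1 _]; exact: lt_le_trans t1.
have ih12 : mu.-integrable `[1%R, 2%R] (EFin \o h p).
  exact: integrableS ih.
apply: (@lt_le_trans _ _ (\int[mu]_(t in `[1, 2]) (h p t))).
  apply: (@lt_le_trans _ _ (\int[mu]_(t in `[1, 2]) (expR (- 2)))).
    rewrite Rintegral_cst//= lebesgue_measure_itv/= lte_fin ltr1n/=.
    by rewrite mulr_gt0 ?expR_gt0//; lra.
  apply: le_Rintegral => //.
    apply: continuous_compact_integrable; first exact: segment_compact.
    by apply: continuous_subspaceT => x; exact: cvg_cst.
  move=> t; rewrite /= in_itv/= => /andP[t1 t2].
  rewrite -[leLHS]mul1r ler_pM ?expR_ge0// ?ler_expR ?lerN2//.
  by rewrite -(powRr0 t) ler_powR// ltW.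
rewrite /Rintegral fine_le ?integrable_fin_num//.
apply: ge0_subset_integral => //.
  exact: measurable_int ih.
by move=> t _; rewrite lee_fin mulr_ge0 ?powR_ge0 ?expR_ge0.
Qed.

(** Log-convexity of Gamma combined with its recurrence: integrating
    2 l sqrt t <= l^2 + t against t^p exp (- t), with l^2 = p + 1, makes the two
    terms on the right equal. *)
Lemma Gamma_half_step (p : R) : 0 < p ->
  Num.sqrt (p + 1) * \int[mu]_(t in `]0, +oo[) (h (p + 2^-1) t) <=
  \int[mu]_(t in `]0, +oo[) (h (p + 1) t).
Proof.
move=> p0; set l := Num.sqrt (p + 1).
have l2 : l ^+ 2 = p + 1 by rewrite sqr_sqrtr// addr_ge0// ltW.
have l0 : 0 < l by rewrite sqrtr_gt0 addr_gt0.
have p10 : 0 < p + 1 by rewrite addr_gt0.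
have ph0 : 0 < p + 2^-1 by rewrite addr_gt0.
have i1 := integrable_gamma p0; have i2 := integrable_gamma ph0.
have i3 := integrable_gamma p10.
have rec := Gamma_rec p0.
have i1' : mu.-integrable `]0%R, +oo[ (EFin \o (fun t => l ^+ 2 * h p t)).
  exact: integrable_gammaZ.
have i2' : mu.-integrable `]0%R, +oo[ (EFin \o (fun t => (2 * l) * h (p + 2^-1) t)).
  exact: integrable_gammaZ.
have : \int[mu]_(t in `]0, +oo[) ((2 * l) * h (p + 2^-1) t) <=
  \int[mu]_(t in `]0, +oo[) (l ^+ 2 * h p t + h (p + 1) t).
  apply: le_Rintegral => //.
    exact: (integrableD _ i1' i3).
  move=> t; rewrite /= in_itv/= andbT => t0.
  have tn : (t != 0) by rewrite gt_eqF.
  rewrite (@powRD _ t p 2^-1) ?tn ?implybT// (@powRD _ t p 1) ?tn ?implybT//.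
  rewrite powRr1 ?(ltW t0)// powR12_sqrt ?(ltW t0)//; set s := Num.sqrt t.
  have -> : t = s ^+ 2 by rewrite sqr_sqrtr// ltW.
  have c0 : 0 <= (s ^+ 2) `^ p * expR (- s ^+ 2) by rewrite mulr_ge0 ?powR_ge0 ?expR_ge0.
  rewrite -subr_ge0.
  have -> : l ^+ 2 * ((s ^+ 2) `^ p * expR (- s ^+ 2)) +
   (s ^+ 2) `^ p * s ^+ 2 * expR (- s ^+ 2) -
   2 * l * ((s ^+ 2) `^ p * s * expR (- s ^+ 2)) =
    ((s ^+ 2) `^ p * expR (- s ^+ 2)) * (l - s) ^+ 2 by ring.
  by rewrite mulr_ge0// sqr_ge0.
rewrite RintegralD// !RintegralZl// l2 -rec; set G := \int[mu]_(_ in _) _.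
set G' := \int[mu]_(_ in _) _; lra.
Qed.

Lemma eta_const_ge (n : nat) : (0 < n)%N ->
  Num.sqrt (n%:R / 2 + 1) / Num.sqrt pi <= eta_const R n.
Proof.
move=> n0; have p0 : 0 < n%:R / 2 :> R by rewrite divr_gt0// ltr0n.
have step := Gamma_half_step p0.
have ph0 : 0 < n%:R / 2 + 2^-1 :> R by rewrite addr_gt0.
have pos := integral_gamma_gt0 ph0.
rewrite /eta_const /Gamma.
have -> : (n + 4)%:R / 2 - 1 = n%:R / 2 + 1 :> R by rewrite natrD; field.
have -> : (n + 3)%:R / 2 - 1 = n%:R / 2 + 2^-1 :> R by rewrite natrD; field.
have spi : 0 < Num.sqrt pi :> R by rewrite sqrtr_gt0 pi_gt0.
rewrite invfM [_^-1 * _^-1]mulrC mulrA ler_wpM2r ?invr_ge0 ?(ltW spi)//.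
by rewrite ler_pdivlMr.
Qed.

End gamma.

(** * Comparison of the error bounds with eta *)

(** It suffices that cos (5/3) < 0, that is sin (5/6)^2 > 1/2, which follows from
    sin x >= x - x^3 / 6. *)
Lemma pi_le_10_3 (R : realType) : pi <= 10 / 3 :> R.
Proof.
pose a : R := 5 / 6.
have H1 (t : R) : 0 <= t -> `|cos t - 1| <= t ^+ 2 / 2.
  move=> t0; have := @le_increment R cos (fun t => - sin t) _ _ 0 t t0
    (fun t _ => is_derive_cos t) (fun t _ => is_derive_monomial 2^-1 1 t).
  rewrite cos0 expr0n mulr0 subr0 mulrC; apply => s /andP[s0 _].
  have := sin_lipschitz s 0; rewrite sin0 !subr0 normrN (ger0_norm s0).
  by rewrite expr1 mulKf.
have H2 : `|(sin a - a * 1) - (sin 0 - 0 * 1)| <= 1 / 6 * a ^+ 3 - 1 / 6 * 0 ^+ 3.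
  have a0 : 0 <= a by rewrite /a; lra.
  apply: (@le_increment R (fun t => sin t - t * 1) (fun t => cos t - 1) _ _ 0 a a0
    (fun t _ => is_deriveB (is_derive_sin t) (is_derive_linear 1 t)) (fun t _ => is_derive_monomial (1 / 6) 2 t)).
  move=> t /andP[t0 _]; apply: (le_trans (H1 t t0)).
  by rewrite le_eqVlt; apply/orP; left; apply/eqP; field.
have sa : 72 / 100 < sin a.
  move: H2; set s := sin a; rewrite sin0 expr0n /= mulr0 mul0r !subr0 mulr1 ler_norml.
  by move=> /andP[+ _]; rewrite /a; lra.
have c0 : cos (5 / 3 : R) < 0.
  have -> : 5 / 3 = a *+ 2 :> R by rewrite /a -mulr_natl; field.
  rewrite cos_mulr2n cos2sin2; move: sa; set s := sin a => sa.
  have : 0 < (s - 72 / 100) * (s + 72 / 100).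
    by rewrite mulr_gt0//; lra.
  by lra.
rewrite leNgt; apply/negP => pibig.
have : 0 < cos (5 / 3 : R) by apply: cos_gt0_pihalf; apply/andP; split; have := pi_ge0 R; lra.
by rewrite ltNge ltW.
Qed.

(** [moment_weight] divided by the second moment 2^-k of the same coordinate. *)
Definition relative_weight (R : realType) (k : nat) : R :=
  3 - 7 / 2 * (3 / 4) ^+ k + 3 / 2 * (5 / 8) ^+ k.

Lemma moment_weightE (R : realType) (k : nat) :
  moment_weight R k = (1 / 2) ^+ k * relative_weight R k.
Proof.
rewrite /moment_weight /relative_weight cos_moment1 cos_moment2 cos_moment3.
have -> : (3 / 8 : R) = 1 / 2 * (3 / 4) by field.
have -> : (5 / 16 : R) = 1 / 2 * (5 / 8) by field.
by rewrite !exprMn; ring.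
Qed.

Lemma relative_weight_ge0 (R : realType) (k : nat) : (0 < k)%N -> 0 <= relative_weight R k.
Proof.
case: k => // k _; rewrite /relative_weight !exprS.
have b0 : 0 <= (5 / 8 : R) ^+ k by rewrite exprn_ge0.
have a1 : (3 / 4 : R) ^+ k <= 1 by rewrite exprn_ile1//; lra.
lra.
Qed.

(** A linear majorant whose sum over the coordinates stays below n (n + 2) / 2.  For
    k > 8 it exceeds 9, which bounds the left-hand side; smaller k are checked one by
    one. *)
Lemma relative_weight_sqr_le (R : realType) (k : nat) : (0 < k)%N ->
  relative_weight R k ^+ 2 <= (8 / 5 + 19 / 10 * k%:R) / 2.
Proof.
move=> k0; have [k8|k9] := leqP k 8.
  rewrite /relative_weight.
  case: k k0 k8 => [//|k] _ k8.
  by do 8 (case: k k8 => [|k] k8; first by rewrite ?exprSr ?expr0; lra).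
have k9' : 9 <= k%:R :> R by rewrite (ler_nat _ 9).
suff : -3 <= relative_weight R k <= 3 by move=> /andP[? ?]; nra.
rewrite /relative_weight; set a : R := (3 / 4) ^+ k; set b : R := (5 / 8) ^+ k.
have b0 : 0 <= b by rewrite exprn_ge0.
have ba : b <= a by rewrite lerXn2r ?nnegrE//; lra.
have a1 : a <= 1 by rewrite exprn_ile1//; lra.
by apply/andP; split; lra.
Qed.

Lemma sum_relative_weight (R : realType) (p : nat) :
  \sum_(i < p.+2) relative_weight R (minn i.+1 p.+1) ^+ 2 <= p.+2%:R * p.+4%:R / 2.
Proof.
apply: (@le_trans _ _ (\sum_(i < p.+2) (8 / 5 + 19 / 10 * (minn i.+1 p.+1)%:R) / 2)).
  by apply: ler_sum => i _; apply: relative_weight_sqr_le; rewrite leq_min.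
rewrite -mulr_suml ler_wpM2r ?invr_ge0// big_split/= sumr_const card_ord -mulr_sumr.
have -> : \sum_(i < p.+2) (minn i.+1 p.+1)%:R = p.+1%:R * p.+2%:R / 2 + p.+1%:R :> R.
  rewrite big_ord_recr/= (minn_idPr (leqnSn _)); congr (_ + _).
  rewrite (eq_bigr (fun i : 'I_p.+1 => i.+1%:R)); last first.
    by move=> i _; rewrite (minn_idPl _).
  elim: p.+1 => [|q IH]; first by rewrite big_ord0 mul0r mul0r.
  by rewrite big_ord_recr/= IH -!natr1; field.
have E1 : p.+1%:R = p%:R + 1 :> R by rewrite natr1.
have E2 : p.+2%:R = p%:R + 2 :> R by rewrite -addn2 natrD.
have E4 : p.+4%:R = p%:R + 4 :> R by rewrite -addn4 natrD.
rewrite -[(8 / 5) *+ _]mulr_natr E1 E2 E4.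
(* the difference of the two sides is a positive combination of 1 and this square *)
have : 0 <= (p%:R - 7 / 2 : R) ^+ 2 by rewrite sqr_ge0.
nra.
Qed.

Lemma weights_le_eta (R : realType) (p : nat) :
  Num.sqrt (\sum_(i < p.+2) (relative_weight R (minn i.+1 p.+1) / 10) ^+ 2) <=
  Num.sqrt p.+2%:R / (3 * Num.sqrt pi) * eta_const R p.+2.
Proof.
have spi : 0 < Num.sqrt pi :> R by rewrite sqrtr_gt0 pi_gt0.
apply: (@le_trans _ _ (Num.sqrt p.+2%:R / (3 * Num.sqrt pi) *
    (Num.sqrt (p.+2%:R / 2 + 1) / Num.sqrt pi))); last first.
  by rewrite ler_wpM2l ?eta_const_ge// divr_ge0 ?sqrtr_ge0// mulr_ge0 ?sqrtr_ge0.
have -> : Num.sqrt p.+2%:R / (3 * Num.sqrt pi) *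
    (Num.sqrt (p.+2%:R / 2 + 1) / Num.sqrt pi) =
    Num.sqrt p.+2%:R * Num.sqrt (p.+2%:R / 2 + 1) / (3 * pi) :> R.
  rewrite -[in RHS](sqr_sqrtr (pi_ge0 R)); field.
  by rewrite gt_eqF.
have pi3 : 0 < 3 * pi :> R by rewrite mulr_gt0// pi_gt0.
rewrite -(@ler_pXn2r _ 2)// ?nnegrE ?sqrtr_ge0 ?divr_ge0 ?mulr_ge0 ?sqrtr_ge0 ?pi_ge0//.
rewrite sqr_sqrtr; last by apply: sumr_ge0 => i _; rewrite sqr_ge0.
rewrite expr_div_n exprMn !sqr_sqrtr ?ler0n ?addr_ge0 ?divr_ge0 ?ler0n//.
rewrite ler_pdivlMr ?exprn_gt0//.
under eq_bigr do rewrite expr_div_n.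
rewrite -mulr_suml.
have := sum_relative_weight R p; set S := \sum_(i < _) _ => hS.
have E4 : p.+4%:R = p.+2%:R + 2 :> R by rewrite -addn2 natrD.
have pi2 : (3 * pi) ^+ 2 <= 10 ^+ 2 :> R.
  by rewrite ler_pXn2r ?nnegrE ?(ltW pi3)//; have := pi_le_10_3 R; lra.
have S0 : 0 <= S by apply: sumr_ge0 => i _; rewrite sqr_ge0.
apply: (@le_trans _ _ (S / 10 ^+ 2 * 10 ^+ 2)).
  by rewrite ler_wpM2l// divr_ge0// exprn_ge0.
rewrite divfK ?expf_neq0//; apply: (le_trans hS); rewrite E4.
by rewrite le_eqVlt; apply/orP; left; apply/eqP; field.
Qed.

(** * Pseudoinverses and limits of matrices *)

Lemma pinv_row_full (R : realType) (m n : nat) (A : 'M[R]_(m, n)) :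
  A *m A^T \in unitmx -> Defs.pinv A = A^T *m invmx (A *m A^T).
Proof.
move=> uA; apply: (is_pinv_unique (pinvP A)).
have AX : A *m (A^T *m invmx (A *m A^T)) = 1%:M by rewrite mulmxA mulmxV.
split.
- by rewrite AX mul1mx.
- by rewrite -mulmxA AX mulmx1.
- by rewrite AX trmx1.
- by rewrite !trmx_mul trmx_inv trmx_mul !trmxK mulmxA.
Qed.

(** The factor c will be the inverse of the number of sample points: it leaves the
    product unchanged and makes both factors converge. *)
Lemma gsgE (R : realType) (n N : nat) (f : 'cV[R]_n -> R) (x0 : 'cV[R]_n)
    (S : 'M[R]_(n, N)) (c : R) : c != 0 -> c *: (S *m S^T) \in unitmx ->
  gsg f x0 S = invmx (c *: (S *m S^T)) *m (c *: (S *m delta_f f x0 S)).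
Proof.
move=> c0 ucS.
have uS : S *m S^T \in unitmx.
  by rewrite unitmxE -[S *m S^T](scalerK c0) detZ unitrM -unitmxE ucS andbT unitrX ?unitrV ?unitfE.
rewrite /gsg pinv_row_full// trmx_mul trmxK trmx_inv trmx_mul trmxK.
have uc : c \is a GRing.unit by rewrite unitfE.
rewrite invmxZ//.
by rewrite -scalemxAl -scalemxAr scalerA mulVf// scale1r mulmxA.
Qed.

Section matrix_limits.
Context (R : realType) (T : Type) (F : set_system T) {FF : ProperFilter F}.

Lemma cvg_sum_seq (I : Type) (s : seq I) (g : I -> T -> R) (l : I -> R) :
  (forall i, g i x @[x --> F] --> l i) ->
  \sum_(i <- s) g i x @[x --> F] --> \sum_(i <- s) l i.
Proof.
move=> gl; elim: s => [|i s IH].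
  by under eq_fun do rewrite big_nil; rewrite big_nil; exact: cvg_cst.
by under eq_fun do rewrite big_cons; rewrite big_cons; exact: cvgD.
Qed.

Lemma cvg_prod_seq (I : Type) (s : seq I) (g : I -> T -> R) (l : I -> R) :
  (forall i, g i x @[x --> F] --> l i) ->
  \prod_(i <- s) g i x @[x --> F] --> \prod_(i <- s) l i.
Proof.
move=> gl; elim: s => [|i s IH].
  by under eq_fun do rewrite big_nil; rewrite big_nil; exact: cvg_cst.
by under eq_fun do rewrite big_cons; rewrite big_cons; exact: cvgM.
Qed.

Lemma cvg_mx_entries m n (A : T -> 'M[R]_(m, n)) (B : 'M[R]_(m, n)) :
  (forall i j, A x i j @[x --> F] --> B i j) -> A x @[x --> F] --> B.
Proof.
move=> AB; apply/cvg_ballP => eps e0.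
have : F [set x | forall ij : 'I_m * 'I_n, ball (B ij.1 ij.2) eps (A x ij.1 ij.2)].
  by apply: filter_forall => -[i j]; have /cvg_ballP := AB i j; apply.
by apply: filterS => x H; split=> // i j; exact: (H (i, j)).
Qed.

Lemma cvg_det n (A : T -> 'M[R]_n) (B : 'M[R]_n) :
  (forall i j, A x i j @[x --> F] --> B i j) -> \det (A x) @[x --> F] --> \det B.
Proof.
move=> AB; apply: cvg_sum_seq => s; apply: cvgM; first exact: cvg_cst.
by apply: cvg_prod_seq => i.
Qed.

(** The entries of the inverse are quotients of determinants, hence continuous where
    the determinant does not vanish. *)
Lemma cvg_invmx_mul n (A : T -> 'M[R]_n) (B : 'M[R]_n) (b : T -> 'cV[R]_n) (c : 'cV[R]_n) :
  (forall i j, A x i j @[x --> F] --> B i j) -> (forall i, b x i 0 @[x --> F] --> c i 0) ->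
  B \in unitmx ->
  (\forall x \near F, A x \in unitmx) /\
  invmx (A x) *m b x @[x --> F] --> invmx B *m c.
Proof.
move=> AB bc uB; have dB : \det B != 0 by rewrite -unitfE -unitmxE.
have dA := cvg_det AB.
have near_unit : \forall x \near F, A x \in unitmx.
  have : \forall x \near F, \det (A x) != 0.
    have := @cvgr_norm_gt _ _ _ _ _ _ _ dA 0; rewrite normr_gt0 => /(_ _ dB).
    by apply: filterS => x; rewrite normr_gt0.
  by apply: filterS => x; rewrite unitmxE unitfE.
split=> //.
have adj i j : (\adj (A x)) i j @[x --> F] --> (\adj B) i j.
  under eq_fun do rewrite mxE.
  rewrite mxE /cofactor; apply: cvgM; first exact: cvg_cst.
  apply: cvg_det => k l.
  by under eq_fun do rewrite !mxE; rewrite !mxE; exact: AB.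
have main : (\det (A x))^-1 *: (\adj (A x) *m b x) @[x --> F] -->
    (\det B)^-1 *: (\adj B *m c).
  apply: cvg_mx_entries => i j; rewrite ord1.
  under eq_fun do rewrite !mxE.
  rewrite !mxE; apply: cvgM; first exact: cvgV.
  apply: cvg_sum_seq => k; exact: cvgM.
rewrite {2}/invmx uB -scalemxAl.
apply: cvg_trans main; apply: near_eq_cvg.
by apply: filterS near_unit => x uA; rewrite /invmx uA -scalemxAl.
Qed.

End matrix_limits.

(** * Limits along the sampling grids *)

Lemma polar_sample_params (R : realType) (p : nat) (x0 : 'cV[R]_p.+2) (r : R)
    (N : 'I_p.+2 -> nat) (S : 'M[R]_(p.+2, \prod_(i < p.+2) N i)) :
  polar_sample x0 r S ->
  exists (Y : 'I_(\prod_(i < p.+2) N i) -> {dffun forall i : 'I_p.+2, 'I_(N i)})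
    (T : 'I_(\prod_(i < p.+2) N i) -> 'I_p.+2 -> R),
  [/\ bijective Y,
      forall j i, (Y j i)%:R * (polar_range r i / (N i)%:R) <= T j i <=
                  (Y j i).+1%:R * (polar_range r i / (N i)%:R) &
      forall j, col j S = polar_point (T j)].
Proof.
move=> [Y [bY cY]]; have [s sP] := choice cY.
exists Y, (fun j i => s j i.+1); split=> // [j i|j].
  have [/(_ i) + _] := sP j; rewrite /polar_range.
  by rewrite -[X in X - 1]natr1 addrK.
by have [_ /addrI] := sP j; rewrite spherical_polar_point.
Qed.

(** With one sample point per cell, the mean over the columns of S is a Riemann sum
    in the polar parameters, without Jacobian. *)
Lemma sample_mean_cvg (R : realType) (p : nat) (x0 : 'cV[R]_p.+2) (r : R)
    (S : forall N : 'I_p.+2 -> nat, 'M[R]_(p.+2, \prod_(i < p.+2) N i))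
    (g : 'cV[R]_p.+2 -> R) :
  0 <= r ->
  (forall N : 'I_p.+2 -> nat, (forall i, (2 < N i)%N) -> polar_sample x0 r (S N)) ->
  uniformly_close (@polar_range R r p) (fun t => g (polar_point t)) ->
  exists2 l : R, midpoint_mean (@polar_range R r p) m (fun t => g (polar_point t)) @[m --> \oo] --> l &
    (fun N => (\sum_j g (col j (S N))) / (\prod_(i < p.+2) N i)%:R) @ multi_infty p.+2 --> l.
Proof.
move=> r0 SP /(riemann_sum_cvg (fun i => polar_range_ge0 i r0))[l ml lP].
exists l => //; apply/cvgrPdist_le => eps e0.
have [K KP] := lP eps e0; exists (maxn K 3) => // N /= NK.
have N3 i : (2 < N i)%N by rewrite (leq_trans _ (NK i))// leq_maxr.
have [Y [T [bY TY TS]]] := polar_sample_params (SP N N3).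
rewrite (eq_bigr (fun j => g (polar_point (T j)))); last by move=> j _; rewrite TS.
rewrite distrC; apply: KP bY TY => i.
by rewrite (leq_trans _ (NK i))// leq_maxl.
Qed.

(** The grids with an even number of points, at least 8, are those on which the sign
    symmetries and the trigonometric moments are exact. *)
Lemma midpoint_mean_even_cvg (R : realType) n (D : 'I_n -> R) G (l : R) :
  midpoint_mean D m G @[m --> \oo] --> l ->
  midpoint_mean D (2 * (m + 4))%N G @[m --> \oo] --> l.
Proof.
apply: cvg_comp => A [K _ HK]; exists K => // m /= Km; apply: HK => /=.
by rewrite (leq_trans Km)// mul2n -addnn addnAC -addnA leq_addr.
Qed.

(** Off the diagonal, the flip of the i-th coordinate changes the sign of the mean,
    which therefore vanishes. *)
Lemma second_moment_cvg (R : realType) (p : nat) (r : R) (i j : 'I_p.+2) : 0 <= r ->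
  midpoint_mean (@polar_range R r p) m
    (fun t => polar_point t i 0 * polar_point t j 0) @[m --> \oo] -->
  (r ^+ 2 / 3 * cos_moment R 1 ^+ minn i.+1 p.+1) *+ (i == j).
Proof.
move=> r0; have [l ml _] := riemann_sum_cvg (fun k => polar_range_ge0 k r0)
  (gram_uniformly_close i j r0).
suff <- : l = (r ^+ 2 / 3 * cos_moment R 1 ^+ minn i.+1 p.+1) *+ (i == j) by [].
apply/esym; move: ml => /midpoint_mean_even_cvg ml.
have ev m : ~~ odd (2 * (m + 4)) by rewrite mul2n odd_double.
have pos m : (0 < 2 * (m + 4))%N by rewrite addn4 muln_gt0.
have big m : (6 < 2 * (m + 4))%N by rewrite mulnDr (leq_trans _ (leq_addl _ _)).
apply: cvg_unique ml; first exact: norm_hausdorff.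
rewrite [X in X _]/mkset.
have [ij|ij] := eqVneq i j; last first.
  apply: cvg_near_cst; apply: nearW => m.
  have := midpoint_mean_flip r i (fun x => x i 0 * x j 0) (ev m) (pos m).
  set M := midpoint_mean _ _.
  have -> : (fun t => flip i (polar_point t) i 0 * flip i (polar_point t) j 0) =
     (fun t : 'I_p.+2 -> R => -1 * (polar_point t i 0 * polar_point t j 0)).
    by apply/funext => t; rewrite ![flip i _ _ _]mxE eqxx eq_sym (negbTE ij); ring.
  by rewrite /M midpoint_meanZ mulr0n => E; lra.
subst j; rewrite mulr1n.
have E m : midpoint_mean (@polar_range R r p) (2 * (m + 4))
    (fun t => polar_point t i 0 * polar_point t i 0) =
    (r ^+ 2 / 3 - r ^+ 2 / 12 * (2 * (m + 4))%:R^-1 ^+ 2) * cos_moment R 1 ^+ minn i.+1 p.+1.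
  rewrite -interval_mean_sqr// -mean_direction//; congr midpoint_mean.
  by apply/funext => t; rewrite !mxE; ring.
under eq_fun do rewrite E.
apply: cvgM; last exact: cvg_cst.
rewrite -[X in _ --> X]subr0; apply: cvgB; first exact: cvg_cst.
rewrite -(mulr0 (r ^+ 2 / 12)); apply: cvgM; first exact: cvg_cst.
have inv0 : (2 * (m + 4))%:R^-1 @[m --> \oo] --> (0 : R).
  apply: (@squeeze_cvgr _ _ _ _ (fun=> 0) (fun m : nat => (m.+1)%:R^-1)).
  - apply: nearW => m; rewrite invr_ge0 ler0n/= lef_pV2 ?posrE ?ltr0n// ler_nat.
    by lia.
  - exact: cvg_cst.
  - exact: cvg_harmonic.
rewrite -(mulr0 (0 : R)); under eq_fun do rewrite expr2.
exact: cvgM.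
Qed.

Lemma first_moment_limit (R : realType) (p : nat) (r : R) (x0 : 'cV[R]_p.+2)
    (f : 'cV[R]_p.+2 -> R) (U : set 'cV[R]_p.+2) (L l : R) (i : 'I_p.+2) :
  0 <= r -> 0 <= L -> open U -> eball x0 r `<=` U -> class_C 2 U f ->
  lipschitz_hessian f (eball x0 r) L ->
  midpoint_mean (@polar_range R r p) m
    (fun t => polar_point t i 0 * (f (x0 + polar_point t) - f x0)) @[m --> \oo] --> l ->
  `|l - r ^+ 2 / 3 * cos_moment R 1 ^+ minn i.+1 p.+1 * partial i f x0| <=
  L / 6 * (r ^+ 4 / 5) * moment_weight R (minn i.+1 p.+1).
Proof.
move=> r0 L0 oU bU fC fL /midpoint_mean_even_cvg bl.
have := @second_moment_cvg _ _ _ i i r0; rewrite eqxx mulr1n => /midpoint_mean_even_cvg ml.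
have W0 : 0 <= moment_weight R (minn i.+1 p.+1).
  by rewrite moment_weightE mulr_ge0 ?exprn_ge0 ?divr_ge0// relative_weight_ge0// leq_min.
pose u m := midpoint_mean (@polar_range R r p) (2 * (m + 4))
    (fun t => polar_point t i 0 * (f (x0 + polar_point t) - f x0)).
pose v m := midpoint_mean (@polar_range R r p) (2 * (m + 4))
    (fun t => polar_point t i 0 * polar_point t i 0).
have cvg_diff : `|u m - v m * partial i f x0| @[m --> \oo] -->
    `|l - r ^+ 2 / 3 * cos_moment R 1 ^+ minn i.+1 p.+1 * partial i f x0|.
  by apply: cvg_norm; apply: cvgB => //; apply: cvgM => //; exact: cvg_cst.
apply: (cvgr_to_le cvg_diff); apply: nearW => m.
have ev : ~~ odd (2 * (m + 4)) by rewrite mul2n odd_double.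
have big : (6 < 2 * (m + 4))%N by rewrite mulnDr (leq_trans _ (leq_addl _ _)).
apply: (le_trans (mean_remainder i ev big r0 L0 oU bU fC fL)).
rewrite ler_wpM2r// ler_wpM2l ?divr_ge0// interval_mean_pow4//.
exact: leq_trans big.
Qed.

Theorem theorem5p10 (R : realType) (n : nat) (r : R) (x0 : 'cV[R]_n)
    (f : 'cV[R]_n -> R) (U : set 'cV[R]_n) (L_H : R)
    (S : forall N : 'I_n -> nat, 'M[R]_(n, \prod_(i < n) N i)) :
  (2 <= n)%N -> 0 < r ->
  open U -> eball x0 r `<=` U -> class_C 3 U f ->
  lipschitz_hessian f (eball x0 r) L_H ->
  (forall N : 'I_n -> nat, (forall i, (2 < N i)%N) ->
     polar_sample x0 r (S N)) ->
  cvg (gsg f x0 (S N) @[N --> multi_infty n]) /\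
  enorm (lim (gsg f x0 (S N) @[N --> multi_infty n]) - grad f x0) <=
    Num.sqrt n%:R / (3 * Num.sqrt pi) * L_H * eta_const R n * r ^+ 2.
Proof.
case: n x0 f U S => [|[|p]] // x0 f U S _ r0 oU bU fC3 fL SP.
have fC := class_CS fC3; set L := L_H in fL *.
have L0 : 0 <= L := lipschitz_hessian_ge0 fL (ltn0Sn _) r0.
have r0' := ltW r0.
pose k (i : 'I_p.+2) := minn i.+1 p.+1.
have k0 i : (0 < k i)%N by rewrite /k leq_min.
pose d (i : 'I_p.+2) : R := r ^+ 2 / 3 * cos_moment R 1 ^+ k i.
have d0 i : 0 < d i by rewrite mulr_gt0 ?divr_gt0 ?exprn_gt0// cos_moment1 divr_gt0.
pose c (N : 'I_p.+2 -> nat) : R := (\prod_(i < p.+2) N i)%:R^-1.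
pose A (N : 'I_p.+2 -> nat) := c N *: (S N *m (S N)^T).
pose b (N : 'I_p.+2 -> nat) := c N *: (S N *m delta_f f x0 (S N)).
pose B : 'M[R]_p.+2 := diag_mx (\row_i d i).
have AB i j : (fun N => A N i j) @ multi_infty p.+2 --> B i j.
  have [l ml sl] := sample_mean_cvg (g := fun x => x i 0 * x j 0) r0' SP
    (gram_uniformly_close i j r0').
  have -> : B i j = l.
    rewrite !mxE; apply: cvg_unique ml; first exact: norm_hausdorff.
    exact: second_moment_cvg.
  apply: cvg_trans sl; apply: near_eq_cvg; apply: nearW => N.
  rewrite !mxE [RHS]mulrC; congr (_ / _).
  by apply: eq_bigr => a _; rewrite !mxE.
have bl (i : 'I_p.+2) : exists l : R, (fun N => b N i 0) @ multi_infty p.+2 --> l /\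
    `|l - d i * partial i f x0| <= L / 6 * (r ^+ 4 / 5) * moment_weight R (k i).
  have [l ml sl] := sample_mean_cvg (g := fun x => x i 0 * (f (x0 + x) - f x0))
    r0' SP (moment_uniformly_close i r0' L0 oU bU fC fL).
  exists l; split; last exact: (first_moment_limit r0' L0 oU bU fC fL ml).
  apply: cvg_trans sl; apply: near_eq_cvg; apply: nearW => N.
  rewrite !mxE [RHS]mulrC; congr (_ / _).
  by apply: eq_bigr => a _; rewrite !mxE.
have [lf lfP] := choice bl.
pose cl : 'cV[R]_p.+2 := \col_i lf i.
have bcl i : (fun N => b N i 0) @ multi_infty p.+2 --> cl i 0.
  by rewrite mxE; exact: (lfP i).1.
have uB : B \in unitmx.
  by rewrite unitmxE det_diag unitfE; apply/prodf_neq0 => i _; rewrite mxE gt_eqF.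
have [uA cvgAb] := cvg_invmx_mul AB bcl uB.
pose y := invmx B *m cl.
have gsg_cvg : gsg f x0 (S N) @[N --> multi_infty p.+2] --> y.
  apply: cvg_trans cvgAb; apply: near_eq_cvg.
  have N1 : \forall N \near multi_infty p.+2, forall i, (1 <= N i)%N by exists 1%N.
  apply: filterS2 N1 uA => N N1 uAN; rewrite (@gsgE _ _ _ _ _ _ (c N))//.
  by rewrite invr_eq0 pnatr_eq0 -lt0n; apply: prodn_gt0.
have lim_y : lim (gsg f x0 (S N) @[N --> multi_infty p.+2]) = y.
  by apply: cvg_lim gsg_cvg; exact: norm_hausdorff.
split; first by apply/cvg_ex; exists y.
rewrite lim_y.
have yE i : y i 0 = lf i / d i.
  have : (B *m y) i 0 = cl i 0 by rewrite mulmxA mulmxV// mul1mx.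
  by rewrite mul_diag_mx !mxE => <-; rewrite mulrC mulKf// gt_eqF.
have err i : `|(y - grad f x0) i 0| <= L * r ^+ 2 * (relative_weight R (k i) / 10).
  have -> : (y - grad f x0) i 0 = (lf i - d i * partial i f x0) / d i.
    rewrite mxE yE !mxE mulrBl; congr (_ - _).
    by rewrite mulrC mulKf// gt_eqF.
  rewrite normrM [`|(d i)^-1|]ger0_norm ?invr_ge0 ?(ltW (d0 i))//.
  rewrite ler_pdivrMr//; apply: (le_trans (lfP i).2).
  rewrite moment_weightE /d cos_moment1.
  by rewrite le_eqVlt; apply/orP; left; apply/eqP; field.
have Lr : 0 <= L * r ^+ 2 by rewrite mulr_ge0 ?sqr_ge0.
apply: (@le_trans _ _ (L * r ^+ 2 *
    Num.sqrt (\sum_(i < p.+2) (relative_weight R (k i) / 10) ^+ 2))).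
  rewrite -(ger0_norm Lr) -sqrtr_sqr -sqrtrM ?sqr_ge0// mulr_sumr.
  rewrite /enorm ler_sqrt; last by apply: sumr_ge0 => i _; rewrite mulr_ge0 ?sqr_ge0.
  apply: ler_sum => i _; rewrite -exprMn -real_normK ?num_real//.
  rewrite ler_pXn2r// nnegrE// mulr_ge0// divr_ge0// relative_weight_ge0//.
have -> : Num.sqrt p.+2%:R / (3 * Num.sqrt pi) * L * eta_const R p.+2 * r ^+ 2 =
  L * r ^+ 2 * (Num.sqrt p.+2%:R / (3 * Num.sqrt pi) * eta_const R p.+2) by ring.
by rewrite ler_wpM2l// weights_le_eta.
Qed.
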